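(* Let $n\ge2$, $p\ge1$, let $v^1,\dots,v^p$ be distinct points of $\mathbb{TP}^{n-1}$ (with fixed representatives in $\mathbb{R}^n$) such that the tropical polytope $\mathcal{P}$ generated by them is pure, and let $\tilde v^1,\dots,\tilde v^p$ be the symbolically perturbed points associated with $\gamma^1,\dots,\gamma^p\in\mathbb{R}^n$ as described in the context. For real numbers $0<\mu\ll\nu\ll1$, let $\boldsymbol{P}\subset\mathbb{K}^n$ be the cone generated by the vectors $\boldsymbol{v}^1,\dots,\boldsymbol{v}^p$, where $$\boldsymbol{v}^r_i=\bigl(\mu^{-\pi_2(\tilde v^r_i)}\,\nu^{-\pi_3(\tilde v^r_i)}\bigr)\,t^{-\pi_1(\tilde v^r_i)}\qquad(i\in\{1,\dots,n\},\ r\in\{1,\dots,p\}),$$ which is a lift of $\mathcal{P}$. Then the images under the valuation map of the facet-defining half-spaces of $\boldsymbol{P}$ provide an external representation of $\mathcal{P}$. Here ''$0<\mu\ll\nu\ll1$'' means: there exists $\nu_0>0$ such that for every $\nu\in(0,\nu_0)$ there exists $\mu_0>0$ such that the conclusion holds for every $\mu\in(0,\mu_0)$.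
   Context: Tropical projective space: $\mathbb{TP}^{n-1} = \mathbb{R}^n/\mathbb{R}(1,\dots,1)$, with the topology induced by the usual topology of $\mathbb{R}^n$. The tropical polytope generated by $v^1,\dots,v^p\in\mathbb{TP}^{n-1}$ is the set of all $x\in\mathbb{TP}^{n-1}$ (represented in $\mathbb{R}^n$) of the form $x_i=\max_{1\le r\le p}(\lambda_r+v^r_i)$ for $i=1,\dots,n$, with $\lambda_1,\dots,\lambda_p\in\mathbb{R}$. It is pure if it equals the closure of its interior in $\mathbb{TP}^{n-1}$. The sector $\mathcal{S}(a,i)$ is $\{x\in\mathbb{TP}^{n-1}\mid x_i-a_i\ge x_k-a_k\text{ for all }k\}$. A point $v\in\mathcal{P}$ is an extreme point of $\mathcal{P}$ of type $i$ if $v$ is the only point of $\mathcal{P}$ contained in $\mathcal{S}(v,i)$. When $\mathcal{P}$ is pure, every extreme point has a unique type. Tropical half-space: a set $\{x\in\mathbb{TP}^{n-1}\mid\max_{i\in I}(x_i-a_i)\ge\max_{j\notin I}(x_j-a_j)\}$ with $a\in\mathbb{TP}^{n-1}$ and $I$ a non-empty proper subset of $\{1,\dots,n\}$. An external representation of $\mathcal{P}$ is a finite set of tropical half-spaces whose intersection is $\mathcal{P}$. General position: over a totally ordered abelian group $G$ (here $(\mathbb{R},+,\le)$ or $(\mathbb{R}^3,+,\leq_{\mathrm{lex}})$ with the lexicographic order), a square matrix $U=(u_{ij})$ of size $m$ with entries in $G$ is tropically singular if $\max_\sigma(u_{1\sigma(1)}+\dots+u_{m\sigma(m)})$ over permutations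 $\sigma$ of $\{1,\dots,m\}$ is attained by at least two permutations. Points of $G^n$ are in general position if every square submatrix of the matrix with these points as columns is tropically non-singular. Perturbed points: let $e^i\in\mathbb{R}^n$ be the $i$-th canonical basis vector and let $\gamma^1,\dots,\gamma^p\in\mathbb{R}^n$ be points in general position. Define $\tilde v^r\in(\mathbb{R}^3)^n$ by $\tilde v^r=(v^r,e^i,\gamma^r)$ if $v^r$ is an extreme point of $\mathcal{P}$ of type $i$, and $\tilde v^r=(v^r,0,\gamma^r)$ otherwise; here $(x,y,z)$ with $x,y,z\in\mathbb{R}^n$ denotes the element of $(\mathbb{R}^3)^n$ with $k$-th coordinate $(x_k,y_k,z_k)$. For $\alpha=(\alpha_1,\alpha_2,\alpha_3)\in\mathbb{R}^3$, $\pi_i(\alpha)=\alpha_i$. The points $\tilde v^1,\dots,\tilde v^p$ are in general position over $(\mathbb{R}^3,+,\le_{\mathrm{lex}})$. Hahn series: $\mathbb{K}$ is the field of real Hahn series $\boldsymbol{x}=\sum_{\alpha\in\mathbb{R}}x_\alpha t^\alpha$ ($x_\alpha\in\mathbb{R}$, well-ordered support). For $\boldsymbol{x}\neq 0$, let $\alpha_{\min}(\boldsymbol{x})$ be the least element of the support; $\mathrm{val}(\boldsymbol{x})=-\alpha_{\min}(\boldsymbol{x})$, and $\mathrm{val}(0)=-\infty$. $\boldsymbol{x}$ is positive if $x_{\alpha_{\min}(\boldsymbol{x})}>0$; this makes $\mathbb{K}$ a totally ordered field, and $\mathbb{K}^+$ is the set of positive elements. The map $\mathrm{val}$ is applied coordinate-wise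 to vectors. A lift of $\mathcal{P}$ is any cone $\mathrm{cone}(\{\boldsymbol{v}^1,\dots,\boldsymbol{v}^p\})\subset\mathbb{K}^n$ with $\boldsymbol{v}^r\in(\mathbb{K}^+)^n$ and $\mathrm{val}(\boldsymbol{v}^r)=v^r$ for each $r$. A facet-defining half-space of $\boldsymbol{P}$ is a half-space $\{\boldsymbol{x}\in\mathbb{K}^n\mid\sum_i\boldsymbol{f}_i\boldsymbol{x}_i\ge0\}$ containing $\boldsymbol{P}$ and whose bounding hyperplane meets $\boldsymbol{P}$ in a facet (a face of dimension $n-1$). The image under the valuation map of a half-space $\boldsymbol{H}$ means the image of $\boldsymbol{H}\cap(\mathbb{K}^+)^n$ under $\mathrm{val}$, regarded in $\mathbb{TP}^{n-1}$. *)

(* Defs.v *)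
From HB Require Import structures.
From mathcomp Require Import all_boot all_order all_algebra perm.
From mathcomp Require Import all_classical all_reals all_analysis.

Set Implicit Arguments.
Unset Strict Implicit.
Unset Printing Implicit Defensive.
Import Order.TTheory GRing.Theory Num.Theory.
Import numFieldNormedType.Exports.
Local Open Scope classical_set_scope.
Local Open Scope ring_scope.

Section WellOrdered.
Context {R : realType}.
Implicit Types (A B C : set R).

Definition least A a := A a /\ forall b, A b -> a <= b.

Definition well_ordered A :=
  forall B, B `<=` A -> B !=set0 -> exists a, least B a.

Lemma well_orderedS A B : A `<=` B -> well_ordered B -> well_ordered A.
Proof. by move=> AB woB C CA; apply: woB; apply: subset_trans AB. Qed.

Lemma well_ordered1 a : well_ordered [set a].
Proof.
move=> B Ba [b Bb]; exists b; split=> // c /Ba ->; by rewrite (Ba _ Bb).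
Qed.

Lemma well_ordered0 : well_ordered set0.
Proof. by move=> B B0 [b /B0]. Qed.

Lemma well_orderedU A B :
  well_ordered A -> well_ordered B -> well_ordered (A `|` B).
Proof.
move=> woA woB C CAB [c Cc].
have [CA0|/set0P CA] := eqVneq (C `&` A) set0.
  have CB : C `<=` B.
    move=> x Cx; case: (CAB _ Cx) => // Ax.
    by have : (C `&` A) x by []; rewrite CA0.
  by apply: woB => //; exists c.
have [a [[Ca Aa] amin]] := woA _ (@subIsetr _ C A) CA.
have [CB0|/set0P CB] := eqVneq (C `&` B) set0.
  exists a; split=> // x Cx; apply: amin; split=> //.
  by case: (CAB _ Cx) => // Bx; have : (C `&` B) x by []; rewrite CB0.
have [b [[Cb Bb] bmin]] := woB _ (@subIsetr _ C B) CB.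
have [ab|ba] := leP a b.
  exists a; split=> // x Cx; case: (CAB _ Cx) => ?; first exact: amin.
  by apply: le_trans ab _; exact: bmin.
exists b; split=> // x Cx; case: (CAB _ Cx) => ?; last exact: bmin.
by apply: le_trans (ltW ba) _; exact: amin.
Qed.

Lemma well_ordered_finite A :
  well_ordered A -> well_ordered (-%R @` A) -> finite_set A.
Proof.
move=> woA woN.
have maxA B : B `<=` A -> B !=set0 -> exists2 m, B m & forall b, B b -> b <= m.
  move=> BA [b Bb].
  have [||_ [[m Bm <-] mmin]] := woN (-%R @` B).
  - by apply: image_subset.
  - by exists (- b), b.
  by exists m => // c Bc; rewrite -lerN2; apply: mmin; exists c.
pose lo a := A `&` [set b | b <= a].
have fin a : A a -> finite_set (lo a).
  move=> Aa; apply: contrapT => infa.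
  have [||m [[Am infm] mmin]] := woA [set b | A b /\ ~ finite_set (lo b)].
  - by move=> b [].
  - by exists a.
  have lom : lo m `<=` m |` (A `&` [set b | b < m]).
    by move=> b [Ab /=]; rewrite le_eqVlt => /predU1P[->|]; [left|right].
  apply: infm; apply: sub_finite_set lom _.
  rewrite finite_setU; split; first exact: finite_set1.
  have [->//|/set0P Am0] := eqVneq (A `&` [set b | b < m]) set0.
  have [m' [Am' m'm] m'max] := maxA _ (@subIsetl _ _ _) Am0.
  have : finite_set (lo m').
    by apply: contrapT => infm'; have := mmin m' (conj Am' infm'); rewrite leNgt m'm.
  apply: sub_finite_set => b [Ab bm]; split=> //=; exact: m'max.
have [->//|/set0P A0] := eqVneq A set0.
have [m Am mmax] := maxA _ (@subset_refl _ A) A0.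
by apply: sub_finite_set (fin _ Am) => b Ab; split=> //=; exact: mmax.
Qed.

Lemma well_ordered_pair (Z : set (R * R)) :
  well_ordered (fst @` Z) -> well_ordered (snd @` Z) -> Z !=set0 ->
  exists2 z, Z z & forall z', Z z' -> z.1 + z.2 <= z'.1 + z'.2.
Proof.
move=> wo1 wo2.
pose hasmin (Y : set (R * R)) :=
  exists2 z, Y z & forall z', Y z' -> z.1 + z.2 <= z'.1 + z'.2.
pose lo (Y : set (R * R)) a := Y `&` [set z | z.1 < a].
have step Y : Y `<=` Z -> Y !=set0 -> ~ hasmin Y ->
    exists2 z, Y z & lo Y z.1 !=set0 /\ ~ hasmin (lo Y z.1).
  move=> YZ [y Yy] nY.
  have [||_ [[z Yz <-] zmin]] := wo2 (snd @` Y).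
  - by apply: image_subset.
  - by exists y.2, y.
  exists z => //; split.
    have [lo0|/set0P //] := eqVneq (lo Y z.1) set0; case: nY.
    exists z => // z' Yz'; apply: lerD; last by apply: zmin; exists z'.
    rewrite leNgt; apply/negP => z'z.
    by have : lo Y z.1 z' by []; rewrite lo0.
  move=> [w [Yw wz] wmin]; apply: nY.
  have hi z' : Y z' -> ~ z'.1 < z.1 -> z.1 + z.2 <= z'.1 + z'.2.
    move=> Yz' /negP; rewrite -leNgt => zz'; apply: lerD => //.
    by apply: zmin; exists z'.
  have [le|/ltW le] := leP (z.1 + z.2) (w.1 + w.2).
    exists z => // z' Yz'; have [zz'|/negP] := boolP (z'.1 < z.1); last exact: hi.
    by apply: le_trans le _; exact: wmin.
  exists w => // z' Yz'; have [zz'|/negP nzz'] := boolP (z'.1 < z.1).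
    exact: wmin.
  by apply: le_trans le _; exact: hi.
move=> Z0; apply: contrapT => nZ.
have [z Zz [z0 nz]] := step _ (@subset_refl _ Z) Z0 nZ.
pose S := fst @` [set z | Z z /\ (lo Z z.1 !=set0 /\ ~ hasmin (lo Z z.1))].
have [||_ [[s [Zs [s0 ns]] <-] smin]] := wo1 S.
- by move=> _ [y [Zy _] <-]; exists y.
- by exists z.1, z.
have [y [Zy ys] [y0 ny]] := step _ (@subIsetl _ _ _) s0 ns.
have loE : lo (lo Z s.1) y.1 = lo Z y.1.
  apply/seteqP; split=> x; first by move=> [[Zx _] /= xy].
  by move=> [Zx /= xy]; split=> //; split=> //=; exact: lt_trans xy ys.
rewrite loE in y0 ny.
have /smin : S y.1 by exists y.
by rewrite leNgt ys.
Qed.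

Lemma well_ordered_add A B : well_ordered A -> well_ordered B ->
  well_ordered [set a + b | a in A & b in B].
Proof.
move=> woA woB C CAB [c Cc].
pose Z := [set z : R * R | [/\ A z.1, B z.2 & C (z.1 + z.2)]].
have [|||[a b] /= [Aa Bb Cab] abmin] := @well_ordered_pair Z.
- by apply: well_orderedS _ woA => _ [z [? ? ?] <-].
- by apply: well_orderedS _ woB => _ [z [? ? ?] <-].
- by have [a Aa [b Bb abc]] := CAB _ Cc; exists (a, b); split; rewrite //= abc.
exists (a + b); split=> // x Cx; have [a' Aa' [b' Bb' xE]] := CAB _ Cx.
by rewrite -xE; apply: (abmin (a', b')); split=> //=; rewrite xE.
Qed.

Lemma well_ordered_fiber A B c : well_ordered A -> well_ordered B ->
  finite_set (A `&` [set a | B (c - a)]).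
Proof.
move=> woA woB; apply: well_ordered_finite.
  exact: well_orderedS (@subIsetl _ _ _) woA.
have : well_ordered [set a + b | a in [set - c] & b in B].
  by apply: well_ordered_add => //; exact: well_ordered1.
apply: well_orderedS => _ [a [Aa Bca] <-].
by exists (- c) => //; exists (c - a) => //; rewrite addKr.
Qed.

End WellOrdered.

Definition supp (R : realType) (f : R -> R) : set R := [set a | f a != 0].

(* Real Hahn series: the series with coefficients x_a is the function a |-> x_a.
   The field operations and the order are installed below, making hahn R a
   realFieldType. *)
Record hahn (R : realType) :=
  Hahn { hcoef :> R -> R; hahn_wo : well_ordered (supp hcoef) }.
Arguments hahn_wo {R} _.

Section HahnField.
Context {R : realType}.
Implicit Types (x y z : hahn R) (a b c : R).

HB.instance Definition _ := gen_eqMixin (hahn R).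
HB.instance Definition _ := gen_choiceMixin (hahn R).

Lemma hahnP x y : (forall a, x a = y a) -> x = y.
Proof.
case: x y => [f wof] [g wog] /= fg.
have {}fg : f = g by apply/funext.
by subst g; congr Hahn; exact: Prop_irrelevance.
Qed.

Let zero_wo : well_ordered (supp (fun=> 0 : R)).
Proof. by apply: well_orderedS _ well_ordered0 => a; rewrite /supp /= eqxx. Qed.

Let opp_wo x : well_ordered (supp (fun a => - x a)).
Proof. by apply: well_orderedS _ (hahn_wo x) => a; rewrite /supp /= oppr_eq0. Qed.

Let add_wo x y : well_ordered (supp (fun a => x a + y a)).
Proof.
apply: well_orderedS _ (well_orderedU (hahn_wo x) (hahn_wo y)) => a.
rewrite /supp /=; have [->|xa] := eqVneq (x a) 0; last by left.
by rewrite add0r; right.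
Qed.

Definition hzero := Hahn zero_wo.
Definition hopp x := Hahn (@opp_wo x).
Definition hadd x y := Hahn (@add_wo x y).

Let haddA : associative hadd.
Proof. by move=> x y z; apply: hahnP => a /=; rewrite addrA. Qed.
Let haddC : commutative hadd.
Proof. by move=> x y; apply: hahnP => a /=; rewrite addrC. Qed.
Let hadd0 : left_id hzero hadd.
Proof. by move=> x; apply: hahnP => a /=; rewrite add0r. Qed.
Let haddN : left_inverse hzero hopp hadd.
Proof. by move=> x; apply: hahnP => a /=; rewrite addNr. Qed.

HB.instance Definition _ :=
  GRing.isZmodule.Build (hahn R) haddA haddC hadd0 haddN.

Lemma hcoef0 a : (0 : hahn R) a = 0. Proof. by []. Qed.
Lemma hcoefN x a : (- x) a = - x a. Proof. by []. Qed.
Lemma hcoefD x y a : (x + y) a = x a + y a. Proof. by []. Qed.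
Lemma hcoefB x y a : (x - y) a = x a - y a. Proof. by []. Qed.
Lemma hcoef_sum (I : Type) (r : seq I) (P : pred I) (F : I -> hahn R) a :
  (\sum_(i <- r | P i) F i) a = \sum_(i <- r | P i) F i a.
Proof. exact: (big_morph (fun x => hcoef x a)). Qed.

Definition mono_coef c a : R -> R := fun b => if b == a then c else 0.

Let mono_wo c a : well_ordered (supp (mono_coef c a)).
Proof.
apply: well_orderedS _ (@well_ordered1 _ a) => b.
by rewrite /supp /mono_coef /=; have [->//|_] := eqVneq b a; rewrite eqxx.
Qed.

(* The monomial c t^a. *)
Definition mono c a := Hahn (@mono_wo c a).

(* The sum is finite by well_ordered_fiber; \sum_(a \in _) is the sum over the
   support of the summand. *)
Definition mul_coef x y : R -> R :=
  fun c => \sum_(a \in [set: R]) x a * y (c - a).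

Let mul_fin x y c : finite_set (supp x `&` [set a | supp y (c - a)]).
Proof. apply: well_ordered_fiber; exact: hahn_wo. Qed.

Let mul_coefE x y c (F : set R) : supp x `&` [set a | supp y (c - a)] `<=` F ->
  mul_coef x y c = \sum_(a \in F) x a * y (c - a).
Proof.
move=> sF; apply/esym/fsbig_widen => // a /= [_ nFa].
have [->|xa] := eqVneq (x a) 0; first by rewrite mul0r.
have [->|ya] := eqVneq (y (c - a)) 0; first by rewrite mulr0.
by case: nFa; apply: sF.
Qed.

Let supp_mul x y :
  supp (mul_coef x y) `<=` [set a + b | a in supp x & b in supp y].
Proof.
move=> c sc; apply: contrapT => nc; move/eqP: sc; apply.
rewrite /mul_coef fsbig1 // => a _.
have [->|xa] := eqVneq (x a) 0; first by rewrite mul0r.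
have [->|ya] := eqVneq (y (c - a)) 0; first by rewrite mulr0.
by case: nc; exists a => //; exists (c - a) => //; rewrite addrC subrK.
Qed.

Let mul_wo x y : well_ordered (supp (mul_coef x y)).
Proof.
apply: well_orderedS (@supp_mul x y) _.
apply: well_ordered_add; exact: hahn_wo.
Qed.

Definition hone := mono 1 0.
Definition hmul x y := Hahn (@mul_wo x y).

Let hmulC : commutative hmul.
Proof.
move=> x y; apply: hahnP => c /=; rewrite /mul_coef.
rewrite (@reindex_fsbigT _ _ _ _ _ (fun a => c - a)); last first.
  by exists (fun a => c - a) => a; rewrite subKr.
by apply: eq_fsbigr => a _; rewrite subKr mulrC.
Qed.

Let hmulA : associative hmul.
Proof.
move=> x y z; apply: hahnP => d /=.
pose FB := supp x `&` [set b | supp (hmul y z) (d - b)].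
pose SA := [set a + b | a in supp x & b in supp y].
pose FB' := supp x `&`
  [set b | [set a + c | a in supp y & c in supp z] (d - b)].
have finB : finite_set FB'.
  apply: well_ordered_fiber; first exact: hahn_wo.
  by apply: well_ordered_add; exact: hahn_wo.
pose FA := SA `&` [set a | supp z (d - a)].
have finA : finite_set FA.
  apply: well_ordered_fiber; last exact: hahn_wo.
  by apply: well_ordered_add; exact: hahn_wo.
transitivity (\sum_(b \in FB') \sum_(a \in FA) x b * y (a - b) * z (d - a)).
  rewrite (@mul_coefE x _ d FB'); last first.
    by move=> b [xb /supp_mul].
  apply: eq_fsbigr => b; rewrite inE => -[xb _] /=.
  rewrite /mul_coef (@reindex_fsbigT _ _ _ _ _ (fun a => a - b)); last first.
    by exists (fun a => a + b) => a; rewrite (subrK, addrK).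
  rewrite mulr_fsumr.
  transitivity (\sum_(a \in [set: R]) x b * y (a - b) * z (d - a)).
    by apply: eq_fsbigr => a _; rewrite mulrA opprB addrA subrK.
  apply/esym/fsbig_widen => // a /= [_ nFa].
  have [->|ya] := eqVneq (y (a - b)) 0; first by rewrite mulr0 mul0r.
  have [->|za] := eqVneq (z (d - a)) 0; first by rewrite mulr0.
  case: nFa; split=> //; exists b => //; exists (a - b) => //.
  by rewrite addrC subrK.
rewrite exchange_fsbig // (@mul_coefE _ z d FA); last first.
  by move=> a [/supp_mul].
apply: eq_fsbigr => a; rewrite inE => -[_ za] /=.
rewrite /mul_coef mulr_fsuml; apply: fsbig_widen => // b /= [_ nFb].
have [->|xb] := eqVneq (x b) 0; first by rewrite !mul0r.
have [->|yb] := eqVneq (y (a - b)) 0; first by rewrite mulr0 mul0r.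
case: nFb; split=> //; exists (a - b) => //; exists (d - a) => //.
by rewrite addrC addrA subrK.
Qed.

Let hmul1 : left_id hone hmul.
Proof.
move=> x; apply: hahnP => c /=.
rewrite (@mul_coefE hone x c [set 0]).
  by rewrite fsbig_set1 /= /mono_coef eqxx mul1r subr0.
by move=> a [+ _]; rewrite /supp /= /mono_coef; have [->//|_] := eqVneq a 0; rewrite eqxx.
Qed.

Let hmulDl : left_distributive hmul hadd.
Proof.
move=> x y z; apply: hahnP => c /=.
pose F := (supp x `|` supp y) `&` [set a | supp z (c - a)].
have finF : finite_set F.
  apply: well_ordered_fiber; last exact: hahn_wo.
  by apply: well_orderedU; exact: hahn_wo.
rewrite !(@mul_coefE _ z c F); last 3 first.
- by move=> a [ya ?]; split=> //; right.
- by move=> a [ya ?]; split=> //; left.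
- move=> a [xya ?]; split=> //; move: xya; rewrite /supp /=.
  have [->|xa] := eqVneq (x a) 0; last by left.
  by rewrite add0r; right.
rewrite -fsbig_split //.
by apply: eq_fsbigr => a _ /=; rewrite mulrDl.
Qed.

Let hone_neq0 : hone != 0.
Proof.
apply/eqP => /(congr1 (fun x => hcoef x 0)) /=.
by rewrite /mono_coef eqxx => /eqP; rewrite oner_eq0.
Qed.

HB.instance Definition _ := GRing.Zmodule_isComNzRing.Build (hahn R)
  hmulA hmulC hmul1 hmulDl hone_neq0.

Lemma hcoefM x y c : (x * y) c = \sum_(a \in [set: R]) x a * y (c - a).
Proof. by []. Qed.

Lemma hcoefME x y c (F : set R) :
  supp x `&` [set a | supp y (c - a)] `<=` F ->
  (x * y) c = \sum_(a \in F) x a * y (c - a).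
Proof. exact: mul_coefE. Qed.

Lemma supp_hmul x y :
  supp (x * y) `<=` [set a + b | a in supp x & b in supp y].
Proof. exact: supp_mul. Qed.

Lemma hcoef1 a : (1 : hahn R) a = if a == 0 then 1 else 0. Proof. by []. Qed.

Lemma hcoef_mono c a b : mono c a b = if b == a then c else 0. Proof. by []. Qed.

Lemma hcoef_monoM c a x b : (mono c a * x) b = c * x (b - a).
Proof.
rewrite (@hcoefME _ _ _ [set a]).
  by rewrite fsbig_set1 hcoef_mono eqxx.
by move=> d [+ _]; rewrite /supp /= /mono_coef; have [->//|_] := eqVneq d a; rewrite eqxx.
Qed.

Lemma mono_mul c a d b : mono c a * mono d b = mono (c * d) (a + b).
Proof.
apply: hahnP => e; rewrite hcoef_monoM !hcoef_mono subr_eq (addrC b).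
by case: ifP => // _; rewrite mulr0.
Qed.

Lemma mono10 : mono 1 0 = 1. Proof. by []. Qed.

Lemma hahn_neq0 x : x != 0 -> supp x !=set0.
Proof.
move=> x0; have [s0|/set0P //] := eqVneq (supp x) set0.
case/eqP: x0; apply: hahnP => a; apply: contrapT => /eqP xa.
by have : supp x a by []; rewrite s0.
Qed.

(* The least element of the support; the default 0 is only used for x = 0. *)
Definition alpha_min x : R := xget 0 (least (supp x)).

Lemma alpha_minP x : x != 0 -> least (supp x) (alpha_min x).
Proof.
move=> /hahn_neq0 x0; rewrite /alpha_min; case: xgetP => // nox.
have [a la] := hahn_wo x _ (@subset_refl _ _) x0.
by case: (nox a).
Qed.

Lemma least_inj (A : set R) a b : least A a -> least A b -> a = b.
Proof.
by move=> [Aa amin] [Ab bmin]; apply/eqP; rewrite eq_le amin ?bmin.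
Qed.

Lemma alpha_min_least x a : least (supp x) a -> alpha_min x = a.
Proof.
move=> la; apply: least_inj (la); apply: alpha_minP.
by apply: contraTneq la.1 => ->; rewrite /supp /= eqxx.
Qed.

Definition hlead x := x (alpha_min x).

Lemma hlead_neq0 x : x != 0 -> hlead x != 0.
Proof. by move=> /alpha_minP[]. Qed.

Lemma alpha_min_low x a : a < alpha_min x -> x a = 0.
Proof.
have [->//|x0] := eqVneq x 0.
move=> ax; apply: contrapT => /eqP xa.
by have /(_ a xa) := (alpha_minP x0).2; rewrite leNgt ax.
Qed.

Lemma hcoefM_lead x y :
  (x * y) (alpha_min x + alpha_min y) = hlead x * hlead y.
Proof.
rewrite (@hcoefME _ _ _ [set alpha_min x]).
  by rewrite fsbig_set1 addrAC subrr add0r.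
move=> a [/= xa ya].
case: (ltgtP a (alpha_min x)) => // [/alpha_min_low|] ax.
  by move: xa; rewrite /supp /= ax eqxx.
have /alpha_min_low yE : alpha_min x + alpha_min y - a < alpha_min y.
  by rewrite ltrBlDr addrC ltrD2l.
by move: ya; rewrite /supp /= yE eqxx.
Qed.

Lemma alpha_minM x y :
  x != 0 -> y != 0 -> alpha_min (x * y) = alpha_min x + alpha_min y.
Proof.
move=> x0 y0; apply: alpha_min_least; split.
  by rewrite /supp /mkset hcoefM_lead mulf_neq0 // hlead_neq0.
move=> _ /supp_hmul[a xa [b yb <-]]; apply: lerD.
- exact: (alpha_minP x0).2.
- exact: (alpha_minP y0).2.
Qed.

(* geo is 1 + e + e^2 + ...: below s *+ N only the first N terms contribute. *)
Section Geometric.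
Variables (e : hahn R) (s : R).
Hypotheses (s_gt0 : 0 < s) (e_low : forall a, supp e a -> s <= a).

Let supp_pow k a : supp (e ^+ k) a -> s *+ k <= a.
Proof.
elim: k a => [|k IH] a.
  rewrite expr0 /supp /mkset hcoef1; have [->//|_] := eqVneq a 0; by rewrite eqxx.
rewrite exprS => /supp_hmul[b eb [c ec <-]].
by rewrite mulrS lerD ?e_low ?IH.
Qed.

Let geo_part N : hahn R := \sum_(k < N) e ^+ k.

Let geo_part_stable N M a : (N <= M)%N -> a < s *+ N ->
  geo_part M a = geo_part N a.
Proof.
move=> NM aN; rewrite /geo_part !hcoef_sum.
rewrite -!(big_mkord xpredT (fun k => (e ^+ k) a)) (@big_cat_nat _ _ _ N) //=.
rewrite [X in _ + X]big_nat_cond [X in _ + X]big1 ?addr0 // => k /andP[/andP[Nk _] _].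
apply: contrapT => /eqP /supp_pow ka.
have : a < a by apply: lt_le_trans ka; apply: lt_le_trans aN _; rewrite ler_pMn2l.
by rewrite ltxx.
Qed.

Let N_of a := Num.bound `|a / s|.

Let N_ofP a : a < s *+ N_of a.
Proof.
rewrite -mulr_natr mulrC -ltr_pdivrMr //.
exact: le_lt_trans (ler_norm _) (archi_boundP (normr_ge0 _)).
Qed.

Definition geo_coef a := geo_part (N_of a) a.

Let geo_coefE N a : a < s *+ N -> geo_coef a = geo_part N a.
Proof.
move=> aN; rewrite /geo_coef.
rewrite -(@geo_part_stable _ (maxn (N_of a) N)) ?leq_maxl ?N_ofP //.
by rewrite (@geo_part_stable N) ?leq_maxr.
Qed.

Let geo_wo : well_ordered (supp geo_coef).
Proof.
move=> B BS [b Bb].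
have [||c [[Bc cb] cmin]] :=
    hahn_wo (geo_part (N_of b)) (B `&` [set c | c <= b]).
- move=> c [/BS + /= cb]; rewrite /supp /= (@geo_coefE (N_of b)) //.
  exact: le_lt_trans cb (N_ofP b).
- by exists b; split => //=.
exists c; split=> // d Bd; have [db|/ltW bd] := leP d b.
  by apply: cmin.
exact: le_trans cb bd.
Qed.

Definition geo := Hahn geo_wo.

Lemma geoM : (1 - e) * geo = 1.
Proof.
apply: hahnP => c.
have e_ge0 a : supp (1 - e) a -> 0 <= a.
  rewrite /supp /mkset hcoefB hcoef1; have [->//|_] := eqVneq a 0.
  rewrite sub0r oppr_eq0 => /e_low; apply: le_trans; exact: ltW.
transitivity (((1 - e) * geo_part (N_of c)) c).
  rewrite !hcoefM; apply: eq_fsbigr => a _.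
  have [->|/e_ge0 a0] := eqVneq ((1 - e) a) 0; first by rewrite !mul0r.
  congr (_ * _); rewrite /= (@geo_coefE (N_of c)) //.
  by apply: le_lt_trans (N_ofP c); rewrite gerBl.
rewrite /geo_part -opprB mulNr -subrX1 opprB hcoefB.
suff -> : (e ^+ N_of c) c = 0 by rewrite subr0.
apply: contrapT => /eqP /supp_pow; apply/negP; rewrite -ltNge; exact: N_ofP.
Qed.
End Geometric.

Let hahn_unit x : x != 0 -> exists y, y * x = 1.
Proof.
move=> x0; pose u := mono (hlead x)^-1 (- alpha_min x).
pose e := 1 - u * x.
have e_pos a : supp e a -> 0 < a.
  rewrite /supp /mkset hcoefB hcoef1 hcoef_monoM opprK.
  case: (ltgtP a 0) => // [a0|->].
    by rewrite alpha_min_low ?mulr0 ?subr0 ?eqxx // gtrDr.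
  by rewrite add0r mulVf ?subrr ?eqxx // hlead_neq0.
have [s s0 e_low] : exists2 s, 0 < s & forall a, supp e a -> s <= a.
  have [e0|/set0P e0] := eqVneq (supp e) set0.
    by exists 1 => // a; rewrite e0.
  have [s [es smin]] := hahn_wo e _ (@subset_refl _ _) e0.
  by exists s => //; exact: e_pos.
exists (geo s0 e_low * u); rewrite -mulrA mulrC.
by have := geoM s0 e_low; rewrite {1}/e subKr.
Qed.

Definition hinv x := if x == 0 then 0 else xget 0 [set y | y * x = 1].

Let hmulVf x : x != 0 -> hinv x * x = 1.
Proof.
move=> x0; rewrite /hinv (negPf x0); case: xgetP => // nox.
by have [y /nox] := hahn_unit x0.
Qed.

Let hinv0 : hinv 0 = 0. Proof. by rewrite /hinv eqxx. Qed.

HB.instance Definition _ :=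
  GRing.ComNzRing_isField.Build (hahn R) hmulVf hinv0.

Definition hlt x y := 0 < hlead (y - x).
Definition hle x y := (x == y) || hlt x y.
Definition hnorm x := if hlt x 0 then - x else x.

Lemma hlead0 : hlead 0 = 0. Proof. by []. Qed.

Lemma hleadE x a : (forall b, b < a -> x b = 0) -> x a != 0 -> hlead x = x a.
Proof.
move=> xlow xa; congr hcoef; apply: alpha_min_least; split=> // b xb.
by rewrite leNgt; apply: contra xb => /xlow ->.
Qed.

Lemma hleadN x : hlead (- x) = - hlead x.
Proof.
have [->|x0] := eqVneq x 0; first by rewrite oppr0 hlead0 oppr0.
apply: hleadE => [b /alpha_min_low bx|]; first by rewrite hcoefN bx oppr0.
by rewrite hcoefN oppr_eq0 hlead_neq0.
Qed.

Lemma hleadM x y : hlead (x * y) = hlead x * hlead y.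
Proof.
have [->|x0] := eqVneq x 0; first by rewrite !(mul0r, hlead0).
have [->|y0] := eqVneq y 0; first by rewrite !(mulr0, hlead0).
by rewrite {1}/hlead alpha_minM // hcoefM_lead.
Qed.

Let hlt0 x : hlt 0 x = (0 < hlead x). Proof. by rewrite /hlt subr0. Qed.
Let hgt0 x : hlt x 0 = (hlead x < 0).
Proof. by rewrite /hlt sub0r hleadN oppr_gt0. Qed.

Let hlt0_add x y : hlt 0 x -> hlt 0 y -> hlt 0 (x + y).
Proof.
rewrite !hlt0; wlog le_xy : x y / alpha_min x <= alpha_min y => [th x0 y0|].
  have [|/ltW] := leP (alpha_min x) (alpha_min y) => le; first exact: th.
  by rewrite addrC; exact: th.
move=> x0 y0.
have y_ge0 : 0 <= y (alpha_min x).
  move: le_xy; rewrite le_eqVlt => /predU1P[->|/alpha_min_low ->//].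
  exact: ltW.
have xy0 : 0 < (x + y) (alpha_min x) by rewrite hcoefD ltr_pwDl.
rewrite (@hleadE _ (alpha_min x)) ?gt_eqF // => b bx.
by rewrite hcoefD !alpha_min_low ?addr0 //; exact: lt_le_trans bx le_xy.
Qed.

Let hlt0_mul x y : hlt 0 x -> hlt 0 y -> hlt 0 (x * y).
Proof. by rewrite !hlt0 hleadM; exact: mulr_gt0. Qed.

Let hlt0_ngt0 x : hlt 0 x -> ~~ hlt x 0.
Proof. by rewrite hlt0 hgt0 => /ltW; rewrite leNgt. Qed.

Let hsub_gt0 x y : hlt 0 (y - x) = hlt x y.
Proof. by rewrite hlt0. Qed.

Let hlt0_total x : x != 0 -> hlt 0 x || hlt x 0.
Proof. by move=> /hlead_neq0; rewrite hlt0 hgt0 neq_lt orbC. Qed.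

Let hnormN x : hnorm (- x) = hnorm x.
Proof.
rewrite /hnorm !hgt0 hleadN oppr_lt0 opprK.
case: (ltgtP (hlead x) 0) => // x0.
have [->|/hlead_neq0] := eqVneq x 0; first by rewrite oppr0.
by rewrite x0 eqxx.
Qed.

Let hge0_norm x : hle 0 x -> hnorm x = x.
Proof.
rewrite /hle /hnorm => /predU1P[<-|/hlt0_ngt0/negPf -> //].
by rewrite oppr0 if_same.
Qed.

Let hle_def x y : hle x y = (x == y) || hlt x y. Proof. by []. Qed.

HB.instance Definition _ := Num.IntegralDomain_isLtReal.Build (hahn R)
  hlt0_add hlt0_mul hlt0_ngt0 hsub_gt0 hlt0_total hnormN hge0_norm hle_def.

Lemma hahn_gt0 x : (0 < x) = (0 < x (alpha_min x)).
Proof. exact: hlt0. Qed.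

End HahnField.

Section TropicalProjectiveSpace.
Context (R : realType) (n : nat).
Implicit Types (x y z : 'rV[R]_n).

Definition tp_rel x y : bool := `[< exists c, y = x + const_mx c >].

Let tp_refl : reflexive tp_rel.
Proof. by move=> x; apply/asboolP; exists 0; rewrite raddf0 addr0. Qed.

Let tp_sym : symmetric tp_rel.
Proof.
suff sub x y : tp_rel x y -> tp_rel y x by move=> x y; apply/idP/idP; exact: sub.
by case/asboolP => c ->; apply/asboolP; exists (- c); rewrite raddfN addrK.
Qed.

Let tp_trans : transitive tp_rel.
Proof.
move=> y x z /asboolP[c ->] /asboolP[d ->]; apply/asboolP.
by exists (c + d); rewrite raddfD addrA.
Qed.

Canonical tp_equiv := EquivRel tp_rel tp_refl tp_sym tp_trans.

Definition TP : Type := quotient_topology {eq_quot tp_equiv}%qT.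

HB.instance Definition _ := Quotient.copy TP (quotient_topology {eq_quot tp_equiv}%qT).
HB.instance Definition _ :=
  Topological.copy TP (quotient_topology {eq_quot tp_equiv}%qT).

Definition tproj (x : 'rV[R]_n) : TP := (\pi_TP x)%qT.

Lemma tprojP x y : tproj x = tproj y <-> exists c, y = x + const_mx c.
Proof.
split; first by move/eqmodP/asboolP.
by move=> xy; apply/eqmodP/asboolP.
Qed.

Lemma tproj_surj (X : TP) : exists x, X = tproj x.
Proof. by exists (generic_quotient.repr X); rewrite /tproj reprK. Qed.

Lemma open_TP (U : set TP) : open U <-> open (tproj @^-1` U).
Proof. by []. Qed.

End TropicalProjectiveSpace.
Arguments tproj {R n} x.

Section Tropical.
Context (R : realType) (n p : nat).
Implicit Types (a x : 'rV[R]_n) (v : 'I_p -> 'rV[R]_n) (P : set (TP R n)).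

(* Maxima are taken in \bar R, with the max of an empty family equal to -oo. *)
Definition tropical_polytope v : set (TP R n) :=
  tproj @` [set x : 'rV[R]_n | exists lam : 'I_p -> R, forall i,
    (x 0 i)%:E = \big[maxe/-oo%E]_(r < p) (lam r + v r 0 i)%:E].

Definition pure P := P = closure (interior P).

Definition sector a (i : 'I_n) : set (TP R n) :=
  tproj @` [set x : 'rV[R]_n | forall k, x 0 k - a 0 k <= x 0 i - a 0 i].

(* The point of TP represented by v0 is an extreme point of P of type i. *)
Definition extreme P (v0 : 'rV[R]_n) (i : 'I_n) :=
  P `&` sector v0 i = [set tproj v0].

Definition tropical_halfspace a (I : {set 'I_n}) : set (TP R n) :=
  tproj @` [set x : 'rV[R]_n |
    (\big[maxe/-oo]_(j in ~: I) (x 0 j - a 0 j)%:E <=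
     \big[maxe/-oo]_(i in I) (x 0 i - a 0 i)%:E)%E].

Definition is_tropical_halfspace (H : set (TP R n)) :=
  exists a (I : {set 'I_n}),
    [/\ I != finset.set0, I != [set: 'I_n]%SET & H = tropical_halfspace a I].

Definition external_representation (F : set (set (TP R n))) P :=
  [/\ finite_set F, forall H, F H -> is_tropical_halfspace H
    & \bigcap_(H in F) H = P].

(* The second block e^i of the perturbed point. If P is pure an extreme point
   has only one type, so the choice made by [pick] is irrelevant. *)
Definition extreme_dir P (v0 : 'rV[R]_n) : 'rV[R]_n :=
  if [pick i | `[< extreme P v0 i >]] is Some i then delta_mx 0 i else 0.

Definition perturbed v (gamma : 'I_p -> 'rV[R]_n) (r : 'I_p) (k : 'I_n) :
    R * R * R :=
  (v r 0 k, extreme_dir (tropical_polytope v) (v r) 0 k, gamma r 0 k).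

End Tropical.

Definition pi1 (R : Type) (alpha : R * R * R) : R := alpha.1.1.
Definition pi2 (R : Type) (alpha : R * R * R) : R := alpha.1.2.
Definition pi3 (R : Type) (alpha : R * R * R) : R := alpha.2.

Section GeneralPosition.
Context (G : porderZmodType).

Definition perm_weight m (U : 'M[G]_m) (s : 'S_m) : G := \sum_i U i (s i).

Definition tropically_singular m (U : 'M[G]_m) :=
  exists s t : 'S_m, [/\ s != t, perm_weight U s = perm_weight U t
    & forall u, perm_weight U u <= perm_weight U s].

Definition general_position n p (g : 'I_p -> 'rV[G]_n) :=
  forall m (f : 'I_m -> 'I_n) (h : 'I_m -> 'I_p),
    {homo f : i j / (i < j)%N} -> {homo h : i j / (i < j)%N} ->
    ~ tropically_singular (mxsub f h (\matrix_(i, r) g r 0 i)).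

End GeneralPosition.

Section Cones.
Context (K : realFieldType) (n p : nat).
Implicit Types (P F H S : set 'rV[K]_n) (f : 'rV[K]_n).

Definition cone (V : 'I_p -> 'rV[K]_n) : set 'rV[K]_n :=
  [set x | exists2 c : 'I_p -> K,
    (forall r, 0 <= c r) & x = \sum_r c r *: V r].

Definition halfspace f : set 'rV[K]_n := [set x : 'rV[K]_n | 0 <= \sum_i f 0 i * x 0 i].
Definition hyperplane f : set 'rV[K]_n := [set x : 'rV[K]_n | \sum_i f 0 i * x 0 i = 0].

Definition is_face P F :=
  exists2 f, P `<=` halfspace f & F = P `&` hyperplane f.

(* The linear span of S has dimension d, the rows of A being a basis of it made
   of elements of S. For a set containing 0, such as a face of a cone, this is
   also the dimension of the affine hull. *)
Definition has_dim S (d : nat) :=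
  exists A : 'M[K]_(d, n),
    [/\ row_free A, forall i, S (row i A) & forall x, S x -> (x <= A)%MS].

Definition is_facet P F := is_face P F /\ has_dim F n.-1.

Definition facet_defining P H := exists f,
  [/\ f != 0, H = halfspace f, P `<=` H & is_facet P (P `&` hyperplane f)].

End Cones.

Section Lifts.
Context (R : realType) (n p : nat).
Implicit Types (v : 'I_p -> 'rV[R]_n).

Definition hval (x : hahn R) : \bar R :=
  if x == 0 then -oo%E else (- alpha_min x)%:E.

Definition is_lift v (P : set 'rV[hahn R]_n) :=
  exists2 V : 'I_p -> 'rV[hahn R]_n,
    forall r i, 0 < V r 0 i /\ hval (V r 0 i) = (v r 0 i)%:E & P = cone V.

Definition val_image (H : set 'rV[hahn R]_n) : set (TP R n) :=
  tproj @` [set x : 'rV[R]_n | exists2 X : 'rV[hahn R]_n, H X &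
    forall i, 0 < X 0 i /\ hval (X 0 i) = (x 0 i)%:E].

Definition lift_vectors (w : 'I_p -> 'I_n -> R * R * R) (mu nu : R)
    (r : 'I_p) : 'rV[hahn R]_n :=
  \row_i mono (mu `^ (- pi2 (w r i)) * nu `^ (- pi3 (w r i)))
               (- pi1 (w r i)).

End Lifts.
Arguments val_image {R n} H _.

(* Main.v *)
(** For x outside P let y be the largest point of P below x, normalized by y <= x,
let N be the set of coordinates maximizing x_i - y_i and D its complement.  At the
point t^(-y) the generators of the lifted cone have leading coefficients which are
real vectors c^r supported by the coordinates where v^r - y is maximal, and every
such support meets D.  It suffices to find a facet normal f whose leading
coefficients g at that point are nonpositive on N and negative at some j in N, for
then f(X) < 0 for every lift X of x.

Purity makes the type of an extreme point unique.  Hence each coordinate k of a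
support is also the type of a generator whose support contains k and is contained
in the given one, and that generator has the large entry L = 1/mu at k.  Take D0 in
D minimal such that D0 meets the support of every generator of type j.  Among the
dual functionals g with g_j = -1, consider those minimizing the sum of g_k, where
the coordinates k in D0 receive a small weight w.  When L is large, a functional
with some g_k > 0, k not in D0, is not optimal.  Shooting a ray in the direction
e_j through the lifted cone yields a facet that is optimal at the level of leading
coefficients, because the facets are finitely many.

General position of gamma is only used to see that facet normals have no zero
entry: in the maximal minors, the permutation of maximal gamma-weight cannot be
cancelled. *)

Require Import Defs.
From mathcomp Require Import all_boot all_order all_algebra perm.
From mathcomp Require Import all_classical all_reals all_analysis.
From mathcomp Require Import polyrcf ring lra.

Set Implicit Arguments.
Unset Strict Implicit.
Unset Printing Implicit Defensive.
Import Order.TTheory GRing.Theory Num.Theory.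
Import numFieldNormedType.Exports.
Local Open Scope classical_set_scope.
Local Open Scope ring_scope.

(** * Facets of finitely generated cones *)

Section PolyhedralCones.
Context {K : realFieldType} {n : nat}.
Implicit Types (f g h x y z : 'rV[K]_n).

Definition dot f x : K := \sum_i f 0 i * x 0 i.

Lemma dotDl f g x : dot (f + g) x = dot f x + dot g x.
Proof. by rewrite -big_split; apply: eq_bigr => i _; rewrite mxE mulrDl. Qed.
Lemma dotZl a f x : dot (a *: f) x = a * dot f x.
Proof. by rewrite mulr_sumr; apply: eq_bigr => i _; rewrite mxE mulrA. Qed.
Lemma dotC f x : dot f x = dot x f.
Proof. by apply: eq_bigr => i _; rewrite mulrC. Qed.
Lemma dotDr f x y : dot f (x + y) = dot f x + dot f y.
Proof. by rewrite dotC dotDl !(dotC f). Qed.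
Lemma dotZr a f x : dot f (a *: x) = a * dot f x.
Proof. by rewrite dotC dotZl dotC. Qed.
Lemma dotBl f g x : dot (f - g) x = dot f x - dot g x.
Proof. by rewrite -scaleN1r dotDl dotZl mulN1r. Qed.
Lemma dotBr f x y : dot f (x - y) = dot f x - dot f y.
Proof. by rewrite -scaleN1r dotDr dotZr mulN1r. Qed.
Lemma dot0r f : dot f 0 = 0.
Proof. by rewrite -(scale0r 0) dotZr mul0r. Qed.
Lemma dot_sumr (I : Type) (r : seq I) (P : pred I) f (F : I -> 'rV[K]_n) :
  dot f (\sum_(i <- r | P i) F i) = \sum_(i <- r | P i) dot f (F i).
Proof. by apply: (big_morph (dot f)) => [x y|]; rewrite ?dotDr ?dot0r. Qed.

Lemma mulmx_dot m (A : 'M[K]_(m, n)) h (i : 'I_m) (j : 'I_1) :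
  (A *m h^T) i j = dot h (row i A).
Proof. by rewrite mxE; apply: eq_bigr => k _; rewrite !mxE ord1 mulrC. Qed.

(** Induction on the number of generators. If the functional [f] obtained for the other generators
    is negative at the first one, everything is projected along the first generator onto the kernel
    of [f]. A functional separating the projections, composed with the projection, vanishes at the
    first generator. *)
Theorem farkas p (V : 'I_p -> 'rV[K]_n) z : ~ cone V z ->
  exists2 f, forall r, 0 <= dot f (V r) & dot f z < 0.
Proof.
elim: p V z => [|p IH] V z nz.
  exists (- z) => [[]//|]; rewrite -scaleN1r dotZl mulN1r oppr_lt0.
  have dge0 i : true -> 0 <= z 0 i * z 0 i by rewrite -expr2 sqr_ge0.
  rewrite lt_def sumr_ge0 // andbT; apply/negP; rewrite psumr_eq0 // => /allP z0.
  apply: nz; exists (fun=> 0) => //; rewrite big_ord0.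
  apply/rowP => i; rewrite mxE; apply/eqP.
  by have := z0 i (mem_index_enum _); rewrite mulf_eq0 orbb.
pose W r := V (lift ord0 r).
have nzW : ~ cone W z.
  move=> [c c0 zE]; apply: nz.
  exists (fun r => if unlift ord0 r is Some s then c s else 0).
    by move=> r; case: unliftP => [s|] _.
  rewrite big_ord_recl unlift_none scale0r add0r zE.
  by apply: eq_bigr => s _; rewrite liftK.
have [f fW fz] := IH W z nzW.
have [fV|fV] := leP 0 (dot f (V ord0)).
  by exists f => // r; case: (unliftP ord0 r) => [s|] -> //; exact: fW.
pose a u := dot f u / dot f (V ord0).
pose q u := u - a u *: V ord0.
have fV0 : dot f (V ord0) != 0 by rewrite lt_eqF.
have nzq : ~ cone (fun s => q (W s)) (q z).
  move=> [c c0 qzE]; apply: nz.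
  exists (fun r => if unlift ord0 r is Some s then c s
                   else a z - \sum_s c s * a (W s)).
    move=> r; case: unliftP => [s|] _ //; rewrite subr_ge0.
    apply: (@le_trans _ _ 0); last by rewrite /a ltW // nmulr_rgt0 // invr_lt0.
    rewrite -oppr_ge0 -sumrN; apply: sumr_ge0 => s _.
    rewrite -mulrN mulr_ge0 // /a -mulrN mulr_ge0 // ?fW //.
    by rewrite oppr_ge0 invr_le0 ltW.
  rewrite big_ord_recl unlift_none.
  rewrite [X in _ + X](eq_bigr (fun s => c s *: W s)) => [|s _]; last by rewrite liftK.
  transitivity (a z *: V ord0 + q z); first by rewrite /q addrC subrK.
  rewrite qzE scalerBl -addrA; congr (_ + _).
  rewrite scaler_suml -sumrN -big_split /=; apply: eq_bigr => s _.
  by rewrite /q scalerBr scalerA addrC.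
have [g gW gz] := IH _ _ nzq.
exists (g - (dot g (V ord0) / dot f (V ord0)) *: f) => [r|].
  rewrite dotBl dotZl; case: (unliftP ord0 r) => [s|] ->.
    have := gW s; rewrite /q dotBr dotZr /a => h; apply: le_trans h _.
    by rewrite le_eqVlt; apply/orP; left; apply/eqP; rewrite /W; ring.
  by rewrite divfK // subrr.
move: gz; rewrite /q dotBr dotZr /a dotBl dotZl => h; apply: le_lt_trans h.
by rewrite le_eqVlt; apply/orP; left; apply/eqP; ring.
Qed.

(** * Facet normals and the generators they annihilate *)

Section Facets.
Context {p : nat}.
Variable V : 'I_p -> 'rV[K]_n.

Definition dual f := forall r, 0 <= dot f (V r).
Definition tight f : {set 'I_p} := [set r | dot f (V r) == 0]%SET.
(** Generators outside [T] become zero rows, so that all these matrices have the same size; the row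
    space is the span of the generators in [T]. *)
Definition rows (T : {set 'I_p}) : 'M[K]_(p, n) :=
  \matrix_r (if r \in T then V r else 0).
Definition facet_normal f := [/\ f != 0, dual f & \rank (rows (tight f)) = n.-1].
(** The generators span the whole space; the dual form can be tested directly on functionals. *)
Definition spanning := forall h, (forall r, dot h (V r) = 0) -> h = 0.

Lemma row_rows (T : {set 'I_p}) r : row r (rows T) = if r \in T then V r else 0.
Proof. by apply/rowP => i; rewrite !mxE. Qed.

Lemma rows_ker (T : {set 'I_p}) h :
  reflect (forall r, r \in T -> dot h (V r) = 0) (rows T *m h^T == 0).
Proof.
apply: (iffP eqP) => [/matrixP H r rT|H].
  by have := H r 0; rewrite mulmx_dot row_rows rT mxE.
apply/matrixP => r j; rewrite mulmx_dot row_rows mxE.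
by case: ifP => [/H//|_]; rewrite dot0r.
Qed.

Lemma ker_exists m (A : 'M[K]_(m, n)) : (\rank A < n)%N ->
  exists2 h : 'rV[K]_n, h != 0 & A *m h^T = 0.
Proof.
move=> rA; have : kermx A^T != 0.
  by rewrite kermx_eq0 /row_free mxrank_tr ltn_eqF.
rewrite -nz_row_eq0 => nz; exists (nz_row (kermx A^T)) => //.
apply: trmx_inj; rewrite trmx_mul trmxK trmx0; apply/sub_kermxP.
exact: nz_row_sub.
Qed.

Lemma rank_tight f : f != 0 -> (\rank (rows (tight f)) <= n.-1)%N.
Proof.
move=> f0; have n0 : (0 < n)%N.
  by case: n f f0 => // f; rewrite thinmx0 eqxx.
rewrite -ltnS prednK // ltn_neqAle rank_leq_col andbT.
apply: contra f0 => /eqP rn.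
have /rows_ker/eqP : forall r, r \in tight f -> dot f (V r) = 0.
  by move=> r; rewrite inE => /eqP.
move=> /(congr1 trmx); rewrite trmx_mul trmxK trmx0 => /sub_kermxP.
have /eqP-> : kermx (rows (tight f))^T == 0.
  by rewrite kermx_eq0 /row_free mxrank_tr rn.
by rewrite submx0.
Qed.

(* Along a direction h that vanishes on the tight generators and at z, the
   functional keeps its sign at z and reaches a new tight generator outside the
   span of the old ones. *)
Lemma facet_separation z : spanning -> ~ cone V z ->
  exists2 f, facet_normal f & dot f z < 0.
Proof.
move=> spV /farkas[f df fz].
have f0 g : dot g z < 0 -> g != 0.
  by apply: contraTneq => ->; rewrite dotC dot0r ltxx.
have [k] := ubnP (n.-1 - \rank (rows (tight f))).
elim: k f df fz => // k IH f df fz; rewrite ltnS => rk.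
have := rank_tight (f0 _ fz); rewrite leq_eqVlt => /orP[/eqP re|rlt].
  by exists f => //; split=> //; exact: f0.
(* The tight generators and [z] together still span a proper subspace, which leaves room for a
   direction [h]. *)
have rlt2 : (\rank (col_mx (rows (tight f)) z) < n)%N.
  rewrite -addsmxE (leq_ltn_trans (mxrank_adds_leqif _ _)) //.
  apply: leq_ltn_trans (leq_add (leqnn _) (rank_leq_row z)) _.
  by rewrite addn1 -ltn_predRL.
have [h h0] := ker_exists rlt2.
rewrite mul_col_mx -(@col_mx0 _ p 1) => /eq_col_mx[/eqP/rows_ker hT hz].
have {hz}hz : dot h z = 0.
  have /matrixP/(_ 0 0) := hz; rewrite mulmx_dot mxE.
  by have -> : row 0 z = z by apply/rowP => i; rewrite mxE.
(* By [spanning], [h] is nonzero at some generator; its sign is free because [h] vanishes at [z] and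
   on the tight generators. *)
wlog [r0 hr0] : h h0 hT hz / exists r, dot h (V r) < 0.
  move=> wl; have [[r hr]|nh] := pselect (exists r, dot h (V r) < 0).
    by apply: (wl h) => //; exists r.
  have {}nh r : 0 <= dot h (V r) by rewrite leNgt; apply/negP => ?; apply: nh; exists r.
  have [r hr] : exists r, dot h (V r) != 0.
    apply: contrapT => nr; move/eqP: h0; apply; apply: spV => r.
    by apply: contrapT => /eqP hr; apply: nr; exists r.
  apply: (wl (-1 *: h)).
  - by rewrite scaler_eq0 oppr_eq0 oner_eq0.
  - by move=> s /hT; rewrite dotZl => ->; rewrite mulr0.
  - by rewrite dotZl hz mulr0.
  - by exists r; rewrite dotZl mulN1r oppr_lt0 lt_def hr nh.
(* [f + t *: h] vanishes at [V r] for [t = Q r]; stopping at the smallest such [t] keeps it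
   nonnegative on all generators. *)
pose Q r := dot f (V r) / - dot h (V r).
case: (@arg_minP _ _ _ r0 (fun r => dot h (V r) < 0) Q hr0) => r1 hr1 rmin.
pose f' := f + Q r1 *: h.
have hr1' : 0 < - dot h (V r1) by rewrite oppr_gt0.
have Q0 : 0 <= Q r1 by rewrite /Q divr_ge0 // ltW.
have f'r1 : dot f' (V r1) = 0.
  by rewrite dotDl dotZl /Q invrN mulrN mulNr divfK ?subrr // lt_eqF.
apply: (IH f').
- move=> r; rewrite dotDl dotZl.
  have [hr|hr] := leP 0 (dot h (V r)); first by rewrite addr_ge0 // mulr_ge0.
  have := rmin r hr; rewrite {2}/Q ler_pdivlMr ?oppr_gt0 // mulrN lerNl => hh.
  by rewrite -lerBlDl sub0r.
- by rewrite dotDl dotZl hz mulr0 addr0.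
have sub : (rows (tight f) <= rows (tight f'))%MS.
  apply/row_subP => r; rewrite row_rows; case: ifP => rT; last exact: sub0mx.
  have rT' : r \in tight f'.
    by rewrite inE dotDl dotZl (hT _ rT) mulr0 addr0; move: rT; rewrite inE.
  by rewrite (_ : V r = row r (rows (tight f'))) ?row_sub // row_rows rT'.
have lt : (rows (tight f) < rows (tight f'))%MS.
  rewrite /ltmx sub /=; apply/negP => sub'.
  have : (V r1 <= rows (tight f))%MS.
    apply: submx_trans sub'.
    rewrite (_ : V r1 = row r1 (rows (tight f'))) ?row_sub // row_rows inE.
    by rewrite f'r1 eqxx.
  move=> /submxP[c cE]; have /eqP hT0 := introT (rows_ker (tight f) h) hT.
  have : dot h (V r1) = (V r1 *m h^T) 0 0.
    by rewrite mulmx_dot; congr dot; apply/rowP => i; rewrite mxE.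
  by rewrite cE -mulmxA hT0 mulmx0 mxE -cE => h1; move: hr1; rewrite h1 ltxx.
have rkl := rank_ltmx lt.
apply: leq_trans rk; rewrite ltn_sub2l //.
Qed.

(** In a vanishing sum of nonnegative terms every term vanishes, so only tight generators carry
    nonzero coefficients. *)
Lemma coneP_tight f x : dual f -> cone V x -> dot f x = 0 ->
  (x <= rows (tight f))%MS.
Proof.
move=> df [c c0 ->]; rewrite dot_sumr.
under eq_bigr => r _ do rewrite dotZr.
move=> /eqP; rewrite psumr_eq0 => [/allP H|r _]; last by rewrite mulr_ge0.
apply: summx_sub => r _.
have := H r (mem_index_enum _); rewrite mulf_eq0 => /orP[/eqP->|fr].
  by rewrite scale0r sub0mx.
apply: scalemx_sub.
by rewrite (_ : V r = row r (rows (tight f))) ?row_sub // row_rows inE fr.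
Qed.

Lemma cone_gen r : cone V (V r).
Proof.
exists (fun s => (s == r)%:R) => [s|]; first exact: ler0n.
rewrite (bigD1 r) //= eqxx scale1r big1 ?addr0 // => s /negPf ->.
by rewrite scale0r.
Qed.

Lemma cone0 : cone V 0.
Proof. by exists (fun=> 0) => //; rewrite big1 // => r _; rewrite scale0r. Qed.

Lemma dualP f : dual f <-> cone V `<=` halfspace f.
Proof.
split=> [df x [c c0 ->]|sub r]; last exact: sub (cone_gen r).
rewrite /halfspace /=; change (0 <= dot f (\sum_r c r *: V r)).
rewrite dot_sumr; apply: sumr_ge0 => r _; rewrite dotZr mulr_ge0 //.
Qed.

Lemma facet_normalP f : facet_normal f -> facet_defining (cone V) (halfspace f).
Proof.
move=> [f0 df rk]; exists f; split=> //; first exact/dualP.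
split; first by exists f => //; exact/dualP.
rewrite -rk; set B := rows _.
(* [has_dim] asks for a basis taken from the face itself: a maximal free family of rows of [B], each
   of which is a tight generator or zero. *)
exists (rowsub (maxrankfun B) B); split.
- exact: maxrowsub_free.
- move=> i; rewrite row_rowsub row_rows; case: ifP => [|_].
    by rewrite inE => /eqP fr; split; [exact: cone_gen|].
  split; [exact: cone0 | exact: dot0r].
- move=> x [cx fx]; rewrite eq_maxrowsub; exact: coneP_tight.
Qed.

Lemma facet_definingP H : facet_defining (cone V) H ->
  exists2 f, facet_normal f & H = halfspace f.
Proof.
move=> [f [f0 -> /dualP df [_ [A [Afree AS _]]]]]; exists f => //; split=> //.
apply/eqP; rewrite eqn_leq rank_tight //= -(eqP Afree).
apply: mxrankS; apply/row_subP => i; have [] := AS i; exact: coneP_tight.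
Qed.

(** By the rank condition the functionals vanishing on the tight generators form a line. A negative
    factor would make [f] both nonnegative and nonpositive on the generators, hence zero. *)
Lemma facet_normal_unique f f' : spanning -> facet_normal f ->
  facet_normal f' -> tight f = tight f' -> exists2 s, 0 < s & f' = s *: f.
Proof.
move=> spV [f0 df rk] [f'0 df' rk'] tE.
have n0 : (0 < n)%N by case: (n) f f0 {df rk tE} => // f; rewrite thinmx0 eqxx.
have kE g : tight g = tight f -> (g <= kermx (rows (tight f))^T)%MS.
  move=> gE; apply/sub_kermxP; apply: trmx_inj; rewrite trmx_mul !trmxK trmx0.
  by apply/eqP/rows_ker => r; rewrite -gE inE => /eqP.
have rker : \rank (kermx (rows (tight f))^T) = 1%N.
  by rewrite mxrank_ker mxrank_tr rk -subn1 subKn.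
have /eqmxP fk : (f == kermx (rows (tight f))^T)%MS.
  by rewrite -(geq_leqif (mxrank_leqif_eq (kE f erefl))) rker lt0n mxrank_eq0.
have : (f' <= f)%MS by rewrite fk; apply: kE.
move=> /sub_rVP[s f'E]; exists s => //.
have s0 : s != 0 by apply: contra f'0; rewrite f'E => /eqP->; rewrite scale0r.
rewrite lt_def s0 /= leNgt; apply/negP => sn.
move/eqP: f0; apply; apply: spV => r; apply/le_anti; rewrite df andbT.
by have := df' r; rewrite f'E dotZl nmulr_rge0.
Qed.

Lemma halfspaceZ s f : 0 < s -> halfspace (s *: f) = halfspace f.
Proof.
move=> s0; apply/seteqP; split=> x; rewrite /halfspace /=;
  by rewrite -/(dot _ _) -/(dot _ _) dotZl pmulr_rge0.
Qed.

(** A facet normal is determined up to positive scaling by its tight set, so one representative for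
    each suitable set of generators suffices. *)
Lemma facet_normal_list : spanning -> exists2 s : seq 'rV[K]_n,
  {in s, forall f, facet_normal f} &
  forall f, facet_normal f -> exists2 f', f' \in s & exists2 a, 0 < a & f' = a *: f.
Proof.
move=> spV.
pose F T := xget 0 [set f | facet_normal f /\ tight f = T].
have FP f : facet_normal f -> facet_normal (F (tight f)) /\ tight (F (tight f)) = tight f.
  by move=> ff; rewrite /F; case: xgetP => [g _ []//|/(_ f)]; case.
exists [seq F T | T <- enum {: {set 'I_p}} & `[< facet_normal (F T) >]].
  by move=> f /mapP[T]; rewrite mem_filter => /andP[/asboolP ? _] ->.
move=> f ff; have [FF tF] := FP f ff.
exists (F (tight f)); last exact: facet_normal_unique.
by apply: map_f; rewrite mem_filter mem_enum andbT; apply/asboolP.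
Qed.

Lemma finite_facets : spanning -> finite_set (facet_defining (cone V)).
Proof.
move=> /facet_normal_list[s _ sP].
apply: (@sub_finite_set _ _ [set halfspace f | f in [set` s]]); last first.
  exact/finite_image/finite_seq.
move=> H /facet_definingP[f ff ->]; have [f' f's [a a0 f'E]] := sP f ff.
by exists f' => //; rewrite f'E halfspaceZ.
Qed.

End Facets.
End PolyhedralCones.

(** * Extreme points and their types *)

Lemma bigmaxe_fin (R : realType) (I : finType) (P : pred I) (i0 : I) (a : I -> R) x :
  P i0 -> x%:E = \big[maxe/-oo%E]_(i | P i) (a i)%:E <->
  (forall i, P i -> a i <= x) /\ exists2 i, P i & a i = x.
Proof.
move=> Pi0.
have [|i iP iE] :=
  @Order.TotalTheory.eq_bigmax _ _ I -oo%E i0 P (fun i => (a i)%:E) Pi0.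
  by move=> i _; exact: leNye.
rewrite iE; split=> [[->]|[ax [k Pk akx]]].
  by split=> [k Pk|]; [rewrite -lee_fin -iE le_bigmax_cond|exists i].
congr EFin; apply/le_anti; rewrite -{1}akx ax // andbT.
by rewrite -lee_fin -iE le_bigmax_cond.
Qed.

Section Types.
Context {R : realType} {n p : nat}.
Variable v : 'I_p -> 'rV[R]_n.
Local Notation P := (tropical_polytope v).
Implicit Types (x y z : 'rV[R]_n) (r s : 'I_p) (i k l : 'I_n).

Lemma polytopeP x : (0 < p)%N -> P (tproj x) <-> exists lam : 'I_p -> R,
  (forall i r, lam r + v r 0 i <= x 0 i) /\
  (forall i, exists r, lam r + v r 0 i = x 0 i).
Proof.
move=> p0; split=> [[x' [lam H] /tprojP[c ->]]|[lam [H1 H2]]].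
  exists (fun r => lam r + c); split=> i.
    move=> r; rewrite !mxE addrAC lerD2r.
    by have [h _] := (@bigmaxe_fin _ _ xpredT (Ordinal p0) _ _ isT).1 (H i); exact: h.
  have [_ [r _ rE]] := (@bigmaxe_fin _ _ xpredT (Ordinal p0) _ _ isT).1 (H i).
  by exists r; rewrite !mxE addrAC rE.
exists x => //; exists lam => i; apply/(@bigmaxe_fin _ _ xpredT (Ordinal p0)) => //.
by split=> [r _|]; [exact: H1|have [r] := H2 i; exists r].
Qed.

Lemma sectorP a i x : sector a i (tproj x) <->
  forall k, x 0 k - a 0 k <= x 0 i - a 0 i.
Proof.
split=> [[y H /tprojP[c ->]] k|H]; last by exists x.
by rewrite !mxE ![_ + c]addrC -!addrA lerD2l.
Qed.

(** The largest [lam] for which [lam + v r] stays below [x]. The maximum of these translates over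
    [r] is the largest point of the polytope below [x]. *)
Definition lam_proj x r (i0 : 'I_n) : R :=
  let i := [arg min_(i < i0) (x 0 i - v r 0 i)]%O in x 0 i - v r 0 i.

Lemma lam_projP x r i0 : (forall i, lam_proj x r i0 + v r 0 i <= x 0 i) /\
  exists i, lam_proj x r i0 + v r 0 i = x 0 i.
Proof.
rewrite /lam_proj; case: arg_minP => // i _ imin; split=> [k|].
  by rewrite -lerBrDr imin.
by exists i; rewrite subrK.
Qed.

Lemma polytope_gen r : (0 < n)%N -> P (tproj (v r)).
Proof.
move=> n0; have p0 : (0 < p)%N by apply: leq_trans (ltn_ord r).
apply/polytopeP => //; exists (fun s => lam_proj (v r) s (Ordinal n0)); split=> i.
  by move=> s; have [h _] := lam_projP (v r) s (Ordinal n0).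
exists r; have [_ [k kE]] := lam_projP (v r) r (Ordinal n0).
suff -> : lam_proj (v r) r (Ordinal n0) = 0 by rewrite add0r.
by apply: (addIr (v r 0 k)); rewrite kE add0r.
Qed.

(* Minimizing the sum of v_l - v_k over the generators v in the sector yields a
   minimal generator, which is extreme of type k. *)
Lemma extreme_exists r0 k : exists r, extreme P (v r) k /\
  forall l, v r 0 l - v r0 0 l <= v r 0 k - v r0 0 k.
Proof.
pose Q r := [forall l, v r 0 l - v r0 0 l <= v r 0 k - v r0 0 k].
pose F r := \sum_l (v r 0 l - v r 0 k).
have n0 : (0 < n)%N by apply: leq_trans (ltn_ord k).
have p0 : (0 < p)%N by apply: leq_trans (ltn_ord r0).
have Q0 : Q r0 by apply/forallP => l; rewrite !subrr.
case: (@arg_minP _ _ _ r0 Q F Q0) => r /forallP Qr Fr.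
exists r; split=> //; apply/seteqP; split=> X; last first.
  by move=> ->; split; [exact: polytope_gen|apply/sectorP => l; rewrite !subrr].
move=> [+ +]; have [x ->] := tproj_surj X.
move=> /polytopeP-/(_ p0)[lam [H1 H2]] /sectorP xr.
(* A generator attaining the [k]-th coordinate of [x] lies in the sector of [v r] as well, so
   minimality of [F r] makes it the same projective point as [v r]; then [x] is squeezed between the
   two. *)
have [s sk] := H2 k.
have sr l : v s 0 l - v s 0 k <= v r 0 l - v r 0 k.
  by have := H1 l s; have := xr l; lra.
have Qs : Q s by apply/forallP => l; have := sr l; have := Qr l; lra.
have sE l : v s 0 l - v s 0 k = v r 0 l - v r 0 k.
  apply/eqP; rewrite eq_le sr /= -subr_le0.
  have /eqP : \sum_l (v r 0 l - v r 0 k - (v s 0 l - v s 0 k)) = 0.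
    apply/le_anti; rewrite sumr_ge0 => [|m _]; last by rewrite subr_ge0.
    by rewrite sumrB subr_le0 Fr.
  rewrite psumr_eq0 => [|m _]; last by rewrite subr_ge0.
  by move=> /allP/(_ l (mem_index_enum _))/eqP->.
apply/esym/tprojP; exists (x 0 k - v r 0 k); apply/rowP => l; rewrite !mxE.
by have := sE l; have := H1 l s; have := xr l; lra.
Qed.

(** These neighborhoods of [a] depend on differences of coordinates only, so they are saturated and
    have open images in the projective space. *)
Lemma open_osc (a : 'rV[R]_n) (e : R) :
  open [set x : 'rV[R]_n | forall l m, (x 0 l - x 0 m) - (a 0 l - a 0 m) < e].
Proof.
rewrite openE => x xe; rewrite /interior /=.
suff H l m : nbhs x [set y : 'rV[R]_n | y 0 l - y 0 m - (a 0 l - a 0 m) < e].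
  apply: (@filterS _ _ _ [set y : 'rV[R]_n | forall lm : 'I_n * 'I_n,
      y 0 lm.1 - y 0 lm.2 - (a 0 lm.1 - a 0 lm.2) < e]).
    by move=> y H0 l m; exact: (H0 (l, m)).
  exact: (@filter_forall _ _ (fun (lm : 'I_n * 'I_n) (y : 'rV[R]_n) =>
    y 0 lm.1 - y 0 lm.2 - (a 0 lm.1 - a 0 lm.2) < e) _ _ (fun lm => H lm.1 lm.2)).
have := xe l m; rewrite -subr_gt0.
have [d dE] : {d | d = e - (x 0 l - x 0 m - (a 0 l - a 0 m))} by eexists.
rewrite -dE => d0.
apply/nbhs_ballP; exists (d / 2); first by rewrite /= divr_gt0.
move=> y [_ xy] /=; have := xy 0 l; have := xy 0 m.
rewrite /ball /= !ltr_norml => /andP[? ?] /andP[? ?]; lra.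
Qed.

(* Near an extreme point a of types i and k, only the generator a contributes to
   the i-th and k-th coordinates, so that x_i - a_i = x_k - a_k on P near a. *)
Lemma pure_type_unique r i k : pure P -> extreme P (v r) i -> extreme P (v r) k ->
  i = k.
Proof.
move=> pP ei ek; apply: contrapT => /eqP ik.
have n0 : (0 < n)%N by apply: leq_trans (ltn_ord k).
have p0 : (0 < p)%N by apply: leq_trans (ltn_ord r).
set a := v r in ei ek.
have gap s m : extreme P a m -> tproj (v s) <> tproj a ->
    exists l, v s 0 m - a 0 m < v s 0 l - a 0 l.
  move=> em sa; apply: contrapT => nl; apply: sa.
  have : (P `&` sector a m) (tproj (v s)).
    split; first exact: polytope_gen.
    by apply/sectorP => l; rewrite leNgt; apply/negP => ?; apply: nl; exists l.
  by rewrite em.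
(* A margin [e] common to both types and to the finitely many generators that differ from [a] is
   chosen. *)
pose Gap (e : R) s := forall m, m = i \/ m = k -> tproj (v s) <> tproj a ->
    exists l, v s 0 m - a 0 m + e <= v s 0 l - a 0 l.
have [e e0 eP] : exists2 e, 0 < e & forall s, Gap e s.
  have : \forall e \near (0 : R)^'+, forall s, Gap e s.
    apply: filter_forall => s.
    have [sa|sa] := pselect (tproj (v s) = tproj a).
      by near=> e => m _ /(_ sa).
    have [li hi] := gap s i ei sa; have [lk hk] := gap s k ek sa.
    near=> e => m [] -> _; [exists li|exists lk]; rewrite -lerBrDl; near: e;
      apply: nbhs_right_le; by rewrite subr_gt0.
  move=> H; have : \forall e \near (0 : R)^'+, 0 < e /\ forall s, Gap e s.
    by apply: filterI => //; exact: nbhs_right_gt.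
  by move=> /filter_ex[e [? ?]]; exists e.
pose U := [set x : 'rV[R]_n | forall l m, (x 0 l - x 0 m) - (a 0 l - a 0 m) < e].
(* If a generator other than [a] attained the [m]-th coordinate of [x], the margin would push some
   other coordinate of [x] out of [U]. *)
have PU m m' x : (m = i \/ m = k) -> (m' = i \/ m' = k) -> P (tproj x) -> U x ->
    x 0 m - a 0 m <= x 0 m' - a 0 m'.
  move=> hm hm' /polytopeP-/(_ p0)[lam [H1 H2]] Ux.
  have [s sE] := H2 m.
  have [/tprojP[c aE]|/(eP s m hm)[l hl]] := pselect (tproj (v s) = tproj a).
    have := H1 m' s; rewrite -sE aE !mxE; lra.
  have := Ux l m; have := H1 l s; lra.
have oU : open (tproj @` U).
  apply/open_TP; rewrite (_ : _ @^-1` _ = U); first exact: open_osc.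
  apply/seteqP; split=> x /=; last by exists x.
  move=> [y yU /tprojP[c ->]] l m; rewrite !mxE; have := yU l m; lra.
have : closure (interior P) (tproj a) by rewrite -pP; exact: polytope_gen.
move=> /(_ (tproj @` U))[].
  apply: open_nbhs_nbhs; split=> //; exists a => // l m; by rewrite subrr.
move=> X [iX [x Ux xX]]; rewrite -xX in iX.
have oW : open (tproj @^-1` (interior P) `&` U).
  apply: openI; last exact: open_osc.
  by apply/open_TP; exact: (@open_interior (TP R n)).
have : nbhs x (tproj @^-1` (interior P) `&` U) by apply: open_nbhs_nbhs.
move=> /nbhs_ballP[d /= d0 dW].
(* A small move along the [i]-th axis stays in the polytope but raises the [i]-th coordinate alone,
   which contradicts the equality forced by [PU]. *)
pose y := x + (d / 2) *: delta_mx 0 i.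
have /dW[/interior_subset Py Uy] : ball x d y.
  split=> // i' j'; rewrite /ball /= /y !mxE opprD addrA subrr sub0r normrN.
  rewrite normrM ger0_norm ?divr_ge0 ?(ltW d0) //.
  apply: (@le_lt_trans _ _ (d / 2)); last by lra.
  rewrite ler_piMr ?divr_ge0 ?(ltW d0) //; case: (_ && _); rewrite ?normr1 ?normr0 //.
have Px := interior_subset iX.
have ii : i = i \/ i = k by left.
have kk : k = i \/ k = k by right.
have h1 := PU i k y ii kk Py Uy.
have h2 := PU k i x kk ii Px Ux.
move: h1; rewrite /y !mxE !eqxx /= [k == i]eq_sym (negPf ik) /= mulr1 mulr0; lra.
Unshelve. all: by end_near. Qed.

Definition gen_type r : option 'I_n := [pick i | `[< extreme P (v r) i >]].

Lemma extreme_gen_type r k : pure P -> extreme P (v r) k -> gen_type r = Some k.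
Proof.
move=> pP ek; rewrite /gen_type; case: pickP => [i /asboolP ei|/(_ k)/negP[]].
  by rewrite (pure_type_unique pP ei ek).
exact/asboolP.
Qed.

(** The support, at the point t^(-y), of the leading coefficients of the [r]-th lifted generator. *)
Definition tops y r : {set 'I_n} :=
  [set i | [forall l, v r 0 l - y 0 l <= v r 0 i - y 0 i]]%SET.

Lemma topsP y r i : reflect (forall l, v r 0 l - y 0 l <= v r 0 i - y 0 i) (i \in tops y r).
Proof. by rewrite inE; exact: forallP. Qed.

(** For an extreme [v r'] of type [k] in the [k]-th sector of [v r], write v^r' - y as (v^r' - v^r)
    + (v^r - y). Both summands are maximal at [k], so the sum is maximal only where both are. *)
Lemma tops_typed y r k : pure P -> k \in tops y r ->
  exists r', [/\ gen_type r' = Some k, k \in tops y r' & tops y r' \subset tops y r].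
Proof.
move=> pP /topsP kr; have [r' [/(extreme_gen_type pP) tk rr']] := extreme_exists r k.
have kr' : k \in tops y r'.
  by apply/topsP => l; have := kr l; have := rr' l; lra.
exists r'; split=> //; apply/fintype.subsetP => i /topsP ir'; apply/topsP => l.
by have := ir' k; have := kr i; have := rr' i; have := kr l; lra.
Qed.

Lemma tops_cover y k : (0 < p)%N -> P (tproj y) -> exists r, k \in tops y r.
Proof.
move=> p0 /polytopeP-/(_ p0)[lam [H1 H2]]; have [r rk] := H2 k; exists r.
by apply/topsP => l; have := H1 l r; lra.
Qed.

End Types.

(** * Cones with typed generators *)

Section TypedCones.
Context {R : realFieldType} {n p : nat}.
Variables (S : 'I_p -> {set 'I_n}) (ty : 'I_p -> option 'I_n).
Variables (c : 'I_p -> 'I_n -> R) (B L : R).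
Implicit Types (g : 'I_n -> R) (r : 'I_p) (i j k l : 'I_n).

Definition pairing (u g : 'I_n -> R) := \sum_i u i * g i.
Definition real_dual g := forall r, 0 <= pairing (c r) g.
Definition pos_part g k := Num.max (g k) 0.

Hypothesis n_gt0 : (0 < n)%N.
Hypothesis B1 : 1 <= B.
(** The factor 16 is what [objective_ge] requires; the exponent 8 comes from the last feasibility
    case of [dual_improvement]. *)
Hypothesis LB : 16 * n%:R ^+ 2 * B ^+ 8 <= L.
Hypothesis c_out : forall r i, i \notin S r -> c r i = 0.
Hypothesis c_untyped : forall r i, i \in S r -> ty r != Some i ->
  1 <= B * c r i /\ c r i <= B.
Hypothesis c_typed : forall r i, i \in S r -> ty r = Some i ->
  L <= B * c r i /\ c r i <= L * B.
Hypothesis typed_sub : forall r k, k \in S r ->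
  exists r', [/\ ty r' = Some k, k \in S r' & S r' \subset S r].
Hypothesis S_cover : forall k, exists r, k \in S r.

Let B0 : 0 < B. Proof. exact: lt_le_trans B1. Qed.
Let n1 : 1 <= n%:R :> R. Proof. by rewrite ler1n. Qed.
Let Bexp (m q : nat) : (m <= q)%N -> B ^+ m <= B ^+ q.
Proof. by move=> ?; apply: ler_weXn2l. Qed.
Let nn : n%:R <= n%:R ^+ 2 :> R.
Proof. by rewrite -[leLHS]mulr1 expr2 ler_wpM2l // ler0n. Qed.

Let L_ge m a : (m <= 8)%N -> a <= 16 -> 0 <= a -> a * (n%:R ^+ 2 * B ^+ m) <= L.
Proof.
move=> m8 a16 a0; apply: le_trans LB; rewrite -mulrA.
apply: ler_pM => //; first by rewrite mulr_ge0 ?exprn_ge0 // ltW.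
by apply: ler_wpM2l; [rewrite exprn_ge0 ?ler0n | exact: Bexp].
Qed.

Let L1 : 1 <= L.
Proof.
apply: le_trans (@L_ge 0 1 _ _ _) => //; last by rewrite ler1n.
by rewrite expr0 mulr1 mul1r; apply: le_trans nn.
Qed.
Let L0 : 0 < L. Proof. exact: lt_le_trans L1. Qed.

Lemma typed_exists k : exists r, ty r = Some k /\ k \in S r.
Proof.
have [r kr] := S_cover k; have [r' [? ? _]] := typed_sub kr.
by exists r'.
Qed.

Lemma c_ge0 r i : 0 <= c r i.
Proof.
have [iS|/c_out->//] := boolP (i \in S r).
rewrite -(pmulr_rge0 _ B0).
have [/(c_typed iS)[h _]|/eqP/(c_untyped iS)[h _]] := pselect (ty r = Some i).
  by apply: le_trans h; exact: ltW.
by apply: le_trans h.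
Qed.

Lemma c_leB r i : ty r != Some i -> c r i <= B.
Proof.
move=> ti; have [iS|/c_out->] := boolP (i \in S r); last exact: ltW.
by have [] := c_untyped iS ti.
Qed.

Lemma c_geB r i : i \in S r -> 1 <= B * c r i.
Proof.
move=> iS; have [/(c_typed iS)[h _]|/eqP/(c_untyped iS)[//]] := pselect (ty r = Some i).
exact: le_trans h.
Qed.

Lemma pos_part_ge0 g k : 0 <= pos_part g k.
Proof. by rewrite le_max lexx orbT. Qed.
Lemma pos_part_ge g k : g k <= pos_part g k.
Proof. by rewrite le_max lexx. Qed.
#[local] Hint Resolve pos_part_ge0 pos_part_ge : core.

(** In the constraint of a generator of type [k] the entry at [k] is at least L/B and the others are
    at most B, so a negative [g k] has size at most B^2/L times the positive parts on the
    support. *)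
Lemma typed_coord_ge (A : {pred 'I_n}) g r k :
  ty r = Some k -> k \in S r -> {subset S r <= A} -> 0 <= pairing (c r) g ->
  - (B ^+ 2 * \sum_(i in A) pos_part g i) <= L * g k.
Proof.
move=> tk kS SA; rewrite /pairing (bigD1 k) //= => h.
have G0 : 0 <= \sum_(i in A) pos_part g i by apply: sumr_ge0.
have [gk|gk] := leP 0 (g k).
  apply: (@le_trans _ _ 0); last by rewrite mulr_ge0 // ltW.
  by rewrite oppr_le0 mulr_ge0 // sqr_ge0.
have h2 : \sum_(i < n | i != k) c r i * g i <= B * \sum_(i in A) pos_part g i.
  rewrite mulr_sumr [leRHS]big_mkcond [leLHS]big_mkcond; apply: ler_sum => i _.
  have [->|ik] /= := eqVneq i k.
    by case: ifP => // _; rewrite mulr_ge0 // ltW.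
  have [iS|/c_out->] := boolP (i \in S r); last first.
    by rewrite mul0r; case: ifP => // _; rewrite mulr_ge0 // ltW.
  rewrite (SA _ iS).
  apply: (@le_trans _ _ (c r i * pos_part g i)); first by rewrite ler_wpM2l // c_ge0.
  by rewrite ler_wpM2r // c_leB // tk; apply: contraNN ik => /eqP[->].
have [cL _] := c_typed kS tk.
have h3 : B * c r k * g k <= L * g k by rewrite ler_nM2r.
apply: le_trans h3; rewrite lerNl -mulNr -subr_ge0.
rewrite (_ : _ - _ = B * (B * \sum_(i in A) pos_part g i + c r k * g k)); last by ring.
rewrite mulr_ge0 ?(ltW B0) //; apply: le_trans h _.
by rewrite addrC lerD2r.
Qed.

Let G g := \sum_i pos_part g i.

Lemma neg_bound g k : real_dual g -> - (B ^+ 2 * G g) <= L * g k.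
Proof.
by move=> dg; have [r [tk kS]] := typed_exists k; exact: typed_coord_ge tk kS _ (dg r).
Qed.

(** Chosen for [wE]: raising each of at most [n] coordinates of this weight by 2 B^2 costs at most
    1/4. *)
Definition small_weight := (8 * n%:R * B ^+ 2)^-1.

Let w0 : 0 < small_weight.
Proof. by rewrite invr_gt0 !mulr_gt0 ?exprn_gt0 // ltr0n. Qed.
Let w1 : small_weight <= 1.
Proof.
rewrite invf_le1 ?mulr_gt0 ?exprn_gt0 ?ltr0n //.
rewrite -[leLHS](mul1r 1) ler_pM // ?exprn_ege1 //.
by rewrite -[leLHS](mul1r 1) ler_pM // ler1n.
Qed.
Let wE : n%:R * (small_weight * (2 * B ^+ 2)) = 4^-1.
Proof. by rewrite /small_weight; field; rewrite !gt_eqF // ltr0n. Qed.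

(** Positive parts count with weight at least [small_weight]; by [neg_bound] all negative parts
    together cost at most n B^2/L times [G g], which is at most half of that. *)
Lemma objective_ge Y g : (forall i, small_weight <= Y i <= 1) -> real_dual g ->
  small_weight / 2 * G g <= pairing Y g.
Proof.
move=> Yw dg; have G0 : 0 <= G g by apply: sumr_ge0.
have step i : small_weight * pos_part g i - B ^+ 2 / L * G g <= Y i * g i.
  have /andP[Yi Yi1] := Yw i.
  have [gi|gi] := leP 0 (g i).
    rewrite /pos_part max_l // lerBlDr; apply: (@le_trans _ _ (Y i * g i)).
      by rewrite ler_wpM2r.
    by rewrite lerDl mulr_ge0 // divr_ge0 ?sqr_ge0 // ltW.
  rewrite /pos_part (max_r (ltW gi)) mulr0 sub0r.
  apply: (@le_trans _ _ (g i)); last first.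
    by rewrite -[leLHS]mul1r; apply: ler_wnM2r => //; exact: ltW.
  by rewrite mulrAC -mulNr ler_pdivrMr // (mulrC (g i)) neg_bound.
apply: le_trans (ler_sum (index_enum 'I_n) (P := xpredT) (fun i _ => step i)).
rewrite sumrB -mulr_sumr -/(G g) sumr_const card_ord -mulrnAl -mulrBl.
rewrite ler_wpM2r // lerBrDr -lerBrDl.
rewrite (_ : small_weight - small_weight / 2 = small_weight / 2); last by field.
rewrite -mulr_natr mulrAC ler_pdivrMr // /small_weight -invfM ler_pdivlMl; last first.
  by rewrite !mulr_gt0 ?exprn_gt0 // ltr0n.
rewrite [leLHS](_ : _ = 16 * (n%:R ^+ 2 * B ^+ 4)); last by ring.
exact: L_ge.
Qed.

(** A functional without positive part has no negative part either, by [neg_bound]. *)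
Lemma objective_gt0 Y g : (forall i, small_weight <= Y i <= 1) -> real_dual g ->
  (exists k, g k != 0) -> 0 < pairing Y g.
Proof.
move=> Yw dg [k gk]; apply: lt_le_trans (objective_ge Yw dg).
rewrite mulr_gt0 ?divr_gt0 // lt_def sumr_ge0 // andbT.
apply: contra gk; rewrite psumr_eq0 // => /allP G0.
have {}G0 i : pos_part g i = 0 by apply/eqP/G0/mem_index_enum.
rewrite eq_le; apply/andP; split; first by rewrite -(G0 k).
have := neg_bound k dg; rewrite /G big1 // mulr0 oppr0.
by rewrite pmulr_rge0.
Qed.

Section Improvement.
Variables (D0 : {set 'I_n}) (j : 'I_n).
Hypothesis jD0 : j \notin D0.
Hypothesis hit : forall r, ty r = Some j -> j \in S r ->
  exists2 i, i \in D0 & i \in S r.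
Hypothesis min_hit : forall i, i \in D0 ->
  exists r, [/\ ty r = Some j, j \in S r & forall l, l \in D0 -> l \in S r -> l = i].

Definition weight i : R := if i \in D0 then small_weight else 1.

Lemma weight_bounds i : small_weight <= weight i <= 1.
Proof. by rewrite /weight; case: ifP => _; rewrite ?lexx ?w1 // ltW. Qed.

(** The height L B^2 is tuned to the entry -1 at [j]: a generator has entry at most L B at [j] and
    at least 1/B on the part of its support in [D0]. *)
Definition feasible_dual i : R := if i \in D0 then L * B ^+ 2 else if i == j then -1 else 0.

Lemma feasible_dual_j : feasible_dual j = -1.
Proof. by rewrite /feasible_dual (negPf jD0) eqxx. Qed.

(** A generator whose support misses [D0] cannot have [j] in it: [typed_sub] would yield a generator
    of type [j] with smaller support, which [D0] hits. *)
Lemma real_dual_feasible : real_dual feasible_dual.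
Proof.
move=> r; rewrite /pairing.
have [[i iD0 iS]|nh] := pselect (exists2 i, i \in D0 & i \in S r).
  have cj : c r j <= L * B.
    have [jS|/c_out->] := boolP (j \in S r); last by rewrite mulr_ge0 ?ltW.
    have [/(c_typed jS)[//]|/eqP/(c_untyped jS)[_ h]] := pselect (ty r = Some j).
    by apply: le_trans h _; rewrite ler_peMl // ltW.
  have ji : j != i by apply: contra jD0 => /eqP->.
  rewrite (bigD1 i) //= (bigD1 j) //= addrA addr_ge0 //; last first.
    apply: sumr_ge0 => l /andP[_ lj]; rewrite mulr_ge0 ?c_ge0 //.
    by rewrite /feasible_dual (negPf lj); case: ifP => // _; rewrite mulr_ge0 ?exprn_ge0 ?ltW.
  rewrite feasible_dual_j mulrN1 subr_ge0 /feasible_dual iD0; apply: le_trans cj _.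
  rewrite (_ : _ * (_ * _) = L * B * (B * c r i)); last by ring.
  by rewrite ler_peMr ?c_geB // mulr_ge0 // ltW.
apply: sumr_ge0 => l _.
have [lS|/c_out->] := boolP (l \in S r); last by rewrite mul0r.
rewrite mulr_ge0 ?c_ge0 // /feasible_dual; case: ifP => [lD0|_].
  by case: nh; exists l.
have [lj|//] := eqVneq l j; case: nh.
rewrite lj in lS; have [r' [tj jS sub]] := typed_sub lS.
have [i iD0 iS] := hit tj jS; exists i => //; exact: (fintype.subsetP sub).
Qed.

Lemma objective_feasible_dual : pairing weight feasible_dual <= 4^-1 * L.
Proof.
apply: (@le_trans _ _ (\sum_(i < n) small_weight * (L * B ^+ 2))); last first.
  rewrite sumr_const card_ord -[_ *+ n]mulr_natl -wE.
  rewrite (_ : n%:R * (small_weight * (2 * B ^+ 2)) * L =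
    2 * (n%:R * (small_weight * (L * B ^+ 2)))); last by ring.
  by rewrite ler_peMl ?ler1n // !mulr_ge0 ?exprn_ge0 ?ler0n ?(ltW w0) ?(ltW L0) ?(ltW B0).
apply: ler_sum => i _; rewrite /weight /feasible_dual; case: ifP => // _.
apply: (@le_trans _ _ 0); first by case: ifP => _; rewrite mul1r // oppr_le0.
by rewrite !mulr_ge0 ?exprn_ge0 ?ltW.
Qed.

(** By [free_coords_sub] this set contains every support that misses [D0]. The typed generator in
    the definition makes [typed_coord_ge] available at each of its coordinates. *)
Definition free_coords : {set 'I_n} := [set k | (k \notin D0) &&
  [exists r, [&& ty r == Some k, k \in S r & fintype.disjoint (mem D0) (mem (S r))]]]%SET.

Lemma free_coords_sub r k : k \in S r ->
  fintype.disjoint (mem D0) (mem (S r)) -> k \in free_coords.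
Proof.
move=> kS dis; rewrite inE; apply/andP; split.
  by apply/negP => kD; have := disjointFr dis kD; rewrite kS.
have [r' [tk kS' sub]] := typed_sub kS.
apply/existsP; exists r'; rewrite tk eqxx kS' /=.
exact: disjointWr sub dis.
Qed.

Lemma j_notin_free_coords : j \notin free_coords.
Proof.
apply/negP; rewrite inE => /andP[_ /existsP[r /and3P[/eqP tj jS dis]]].
have [i iD iS] := hit tj jS.
by have := disjointFr dis iD; rewrite iS.
Qed.

(* Unless the explicit functional feasible_dual is already better, the positive part
   of g outside D0 is deleted and compensated by a large multiple of it on D0, where
   the weights are small.  Generators missing D0 would resist the deletion: their
   supports are contained in free_coords, where the negative part of g, which is of
   order 1/L, is deleted as well. *)
Lemma dual_improvement g k : real_dual g -> g j = -1 -> k \notin D0 -> 0 < g k ->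
  exists g', [/\ real_dual g', g' j = -1 & pairing weight g' < pairing weight g].
Proof.
move=> dg gj kD0 gk.
have [gopt|ltg] := leP (pairing weight g) (pairing weight feasible_dual); last first.
  by exists feasible_dual; split; [exact: real_dual_feasible|exact: feasible_dual_j|].
(* The objective is at most L/4 here, and [objective_ge] turns this into a bound on the positive
   parts. *)
have Gb : G g <= 4 * n%:R * L * B ^+ 2.
  have := le_trans (objective_ge weight_bounds dg) (le_trans gopt objective_feasible_dual).
  rewrite -ler_pdivlMl ?divr_gt0 // => h; apply: le_trans h _.
  rewrite le_eqVlt; apply/orP; left; apply/eqP; rewrite /small_weight.
  by field; rewrite !gt_eqF // ltr0n.
pose Sg := \sum_(i in [pred i | i \notin D0]) pos_part g i.
have Sg0 : 0 < Sg.
  rewrite /Sg (bigD1 k) //= ltr_pwDl ?sumr_ge0 //.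
  by rewrite /pos_part max_l // ltW.
have gneg l : - (4 * n%:R * B ^+ 4) <= g l.
  have := neg_bound l dg => h.
  rewrite -(ler_pM2l L0); apply: le_trans h; rewrite mulrN lerN2.
  rewrite (_ : L * _ = B ^+ 2 * (4 * n%:R * L * B ^+ 2)); last by ring.
  by rewrite ler_wpM2l // sqr_ge0.
(* The constraint of a generator of type [j] meeting [D0] in [i] alone: the large entry at [j] must
   be compensated by [g i] or by coordinates outside [D0]. *)
have gD i : i \in D0 -> L <= B ^+ 2 * (pos_part g i + Sg).
  move=> iD; have [r [tj jS ri]] := min_hit iD.
  have := dg r; rewrite /pairing (bigD1 j) //= gj mulrN1 addrC subr_ge0 => h.
  have [Lc _] := c_typed jS tj.
  apply: le_trans Lc _; rewrite expr2 -mulrA ler_wpM2l ?(ltW B0) //.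
  apply: le_trans h _.
  have ij : i != j by apply: contraNneq jD0 => <-.
  rewrite (bigD1 i) //= mulrDr; apply: lerD.
    apply: (@le_trans _ _ (c r i * pos_part g i)); first by rewrite ler_wpM2l // c_ge0.
    by rewrite ler_wpM2r // c_leB // tj; apply: contraNN ij => /eqP[->].
  rewrite /Sg mulr_sumr [leLHS]big_mkcond [leRHS]big_mkcond.
  apply: ler_sum => l _ /=; rewrite inE.
  have [lj|lj] := eqVneq l j => /=; first by case: ifP => // _; rewrite mulr_ge0 // ltW.
  have [lD|lD] := boolP (l \in D0) => /=.
    case: ifP => // li.
    have [lS|/c_out->] := boolP (l \in S r); last by rewrite mul0r.
    by move: li; rewrite (ri l lD lS) eqxx.
  case: ifP => _; last by rewrite mulr_ge0 // ltW.
  apply: (@le_trans _ _ (c r l * pos_part g l)); first by rewrite ler_wpM2l // c_ge0.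
  by rewrite ler_wpM2r // c_leB // tj; apply: contraNN lj => /eqP[->].
(* Entries of a generator on [D0] in its support are at least 1/B, so the raise gains at least 2 B
   Sg, more than the loss B Sg from untyped entries. It also makes [g'] at least L/(2 B^2) on [D0],
   even where [g] was slightly negative. *)
pose g' i := if i \in D0 then g i + 2 * B ^+ 2 * Sg
             else if i \in free_coords then 0 else Num.min (g i) 0.
have g'D i : i \in D0 -> 2^-1 * L <= B ^+ 2 * g' i.
  move=> iD; rewrite /g' iD.
  have Lb : 4 * n%:R * B ^+ 6 <= 2^-1 * L.
    rewrite -ler_pdivrMl ?invr_gt0 // invrK.
    apply: le_trans (@L_ge 6 8 _ _ _) => //; last by rewrite ler_nat.
    rewrite [leLHS](_ : _ = 8 * (n%:R * B ^+ 6)); last by ring.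
    by rewrite ler_wpM2l // ler_wpM2r // exprn_ge0 // ltW.
  have := gD i iD; rewrite /pos_part; case: (leP 0 (g i)) => gi.
    move=> h; apply: (@le_trans _ _ L).
      by rewrite ler_piMl ?(ltW L0) // invf_le1 // ler1n.
    apply: le_trans h _; rewrite ler_wpM2l ?sqr_ge0 // lerD2l.
    rewrite ler_peMl ?(ltW Sg0) // -[leLHS](mul1r 1) ler_pM // ?exprn_ege1 //.
    by rewrite ler1n.
  rewrite add0r => h.
  have h1 : - (4 * n%:R * B ^+ 6) <= B ^+ 2 * g i.
    rewrite (_ : - _ = B ^+ 2 * - (4 * n%:R * B ^+ 4)); last by ring.
    by rewrite ler_wpM2l ?sqr_ge0.
  have h2 : L <= B ^+ 2 * (2 * B ^+ 2 * Sg).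
    apply: le_trans h _; rewrite ler_wpM2l ?sqr_ge0 //.
    rewrite ler_peMl ?(ltW Sg0) // -[leLHS](mul1r 1) ler_pM // ?exprn_ege1 //.
    by rewrite ler1n.
  rewrite mulrDr; lra.
have g'D0 i : i \in D0 -> 0 <= g' i.
  move=> /g'D h; rewrite -(@pmulr_rge0 _ (B ^+ 2)) ?exprn_gt0 //.
  by apply: le_trans h; rewrite mulr_ge0 // ltW.
have g'neg i : - (4 * n%:R * B ^+ 4) <= g' i.
  have m0 : - (4 * n%:R * B ^+ 4) <= 0.
    by rewrite oppr_le0 !mulr_ge0 ?exprn_ge0 // ltW.
  have [iD|iD] := boolP (i \in D0); first by apply: le_trans (g'D0 i iD).
  by rewrite /g' (negPf iD); case: ifP => // _; rewrite le_min gneg.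
have g'diff i : i \notin D0 -> - pos_part g i <= g' i - g i.
  move=> iD; rewrite /g' (negPf iD) /pos_part; case: ifP => _.
    by rewrite sub0r lerN2 le_max lexx.
  by case: (leP 0 (g i)) => gi; rewrite ?subrr ?oppr0 ?sub0r.
exists g'; split.
(* A support that misses [D0] lies in [free_coords], where [g'] vanishes. *)
- move=> r; have [[i iD iS]|nh] := pselect (exists2 i, i \in D0 & i \in S r); last first.
    rewrite /pairing big1 // => l _.
    have [lS|/c_out->] := boolP (l \in S r); last by rewrite mul0r.
    have lN : l \in free_coords.
      apply: free_coords_sub lS _; rewrite disjoint_subset; apply/fintype.subsetP => i iD.
      by rewrite inE; apply/negP => iS; apply: nh; exists i.
    have lD : l \notin D0 by move: lN; rewrite inE => /andP[].
    by rewrite /g' (negPf lD) lN mulr0.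
  (* If [g'] agrees with [g] at a type outside [D0], the large entry of the generator causes no
     loss, and the gain at [i] pays for the rest. *)
  have [same|] := pselect (forall l, l \in S r -> ty r = Some l -> l \notin D0 -> g' l = g l).
    suff : 0 <= \sum_l c r l * (g' l - g l).
      rewrite -(lerD2l (pairing (c r) g)) addr0 => /(le_trans (dg r)).
      rewrite /pairing -big_split /= => h; apply: le_trans h _.
      by apply: ler_sum => l _; rewrite -mulrDr addrC subrK.
    have step l : (if l == i then 2 * B * Sg else 0)
        - B * (if l \in [pred i | i \notin D0] then pos_part g l else 0)
        <= c r l * (g' l - g l).
      have [lD|lD] := boolP (l \in D0).
        rewrite inE lD /= mulr0 subr0 /g' lD [g l + _]addrC addrK.
        have [->|_] := eqVneq l i; last by rewrite !mulr_ge0 ?c_ge0 ?exprn_ge0 ?ltW.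
        rewrite (_ : c r i * _ = 2 * B * Sg * (B * c r i)); last by ring.
        by rewrite ler_peMr ?c_geB // !mulr_ge0 // ltW.
      have li : l != i by apply: contraNneq lD => ->.
      rewrite (negPf li) inE lD /= sub0r.
      have [tl|tl] := eqVneq (ty r) (Some l).
        have [lS|/c_out->] := boolP (l \in S r); last first.
          by rewrite mul0r oppr_le0 mulr_ge0 // ltW.
        by rewrite (same l) // subrr mulr0 oppr_le0 mulr_ge0 // ltW.
      apply: (@le_trans _ _ (c r l * - pos_part g l)); last first.
        by rewrite ler_wpM2l ?c_ge0 ?g'diff.
      by rewrite mulrN lerN2 ler_wpM2r // c_leB.
    apply: le_trans (ler_sum (index_enum 'I_n) (P := xpredT) (fun l _ => step l)).
    rewrite sumrB -big_mkcond big_pred1_eq -mulr_sumr -big_mkcond -/Sg.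
    by rewrite subr_ge0 ler_wpM2r ?(ltW Sg0) // ler_peMl ?(ltW B0) // ler1n.
  (* Otherwise [g'] vanishes at the type [m], so only entries bounded by B meet negative values;
     their total is dominated by the term at [i], at least L/(2 B^3). *)
  move=> /existsNP[m /not_implyP[mS /not_implyP[tm /not_implyP[mD mg]]]].
  have g'm : g' m = 0 \/ g' m = g m.
    rewrite /g' (negPf mD); case: ifP => _; first by left.
    by case: leP => _; [right|left].
  have {mg g'm} g'm : g' m = 0 by case: g'm.
  have step l : (if l == i then 2^-1 * L / B ^+ 3 else 0) - B * (4 * n%:R * B ^+ 4)
      <= c r l * g' l.
    have z0 : 0 <= B * (4 * n%:R * B ^+ 4) by rewrite !mulr_ge0 ?exprn_ge0 // ltW.
    have [->|li] := eqVneq l i.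
      apply: (@le_trans _ _ (2^-1 * L / B ^+ 3)); first by rewrite gerBl.
      rewrite ler_pdivrMr ?exprn_gt0 //.
      rewrite (_ : _ * _ * _ = (B * c r i) * (B ^+ 2 * g' i)); last by ring.
      apply: le_trans (g'D i iD) _.
      by rewrite ler_peMl ?c_geB // mulr_ge0 ?exprn_ge0 ?(ltW B0) // g'D0.
    rewrite sub0r; have [->|lm] := eqVneq l m; first by rewrite g'm mulr0 oppr_le0.
    apply: (@le_trans _ _ (c r l * - (4 * n%:R * B ^+ 4))); last by rewrite ler_wpM2l ?c_ge0.
    rewrite mulrN lerN2 ler_wpM2r //; first by rewrite !mulr_ge0 ?exprn_ge0 // ltW.
    by rewrite c_leB // tm; apply: contraNN lm => /eqP[->].
  apply: le_trans (ler_sum (index_enum 'I_n) (P := xpredT) (fun l _ => step l)).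
  rewrite sumrB -big_mkcond big_pred1_eq sumr_const card_ord subr_ge0.
  rewrite ler_pdivlMr ?exprn_gt0 // -ler_pdivrMl ?invr_gt0 // invrK -[_ *+ n]mulr_natr.
  rewrite [leLHS](_ : _ = 8 * (n%:R ^+ 2 * B ^+ 8)); last by ring.
  by apply: L_ge => //; rewrite ler_nat.
- by rewrite /g' (negPf jD0) (negPf j_notin_free_coords) gj min_l // oppr_le0.
pose P0 := \sum_(i in free_coords) pos_part g i.
have P00 : 0 <= P0 by apply: sumr_ge0.
have P0S : P0 <= Sg.
  rewrite /P0 /Sg [leLHS]big_mkcond [leRHS]big_mkcond; apply: ler_sum => l _.
  by rewrite !inE; case: (l \in D0) => //=; case: ifP.
(* Summed over [l], the raise on [D0] and the deleted negative parts cost at most a quarter of [Sg]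
   each, while [Sg] itself is saved. *)
have step l : weight l * (g' l - g l) <= small_weight * (2 * B ^+ 2) * Sg + B ^+ 2 / L * Sg
    - (if l \in [pred i | i \notin D0] then pos_part g l else 0).
  have z1 : 0 <= small_weight * (2 * B ^+ 2) * Sg by rewrite !mulr_ge0 ?exprn_ge0 ?ltW.
  have z2 : 0 <= B ^+ 2 / L * Sg by rewrite !mulr_ge0 ?exprn_ge0 ?invr_ge0 ?ltW.
  rewrite /weight inE; have [lD|lD] := boolP (l \in D0) => /=.
    by rewrite subr0 /g' lD [g l + _]addrC addrK mulrA lerDl.
  rewrite mul1r /g' (negPf lD); case: ifP => lN.
    rewrite sub0r; have [gl|gl] := leP 0 (g l).
      by rewrite /pos_part max_l // lerDr addr_ge0.
    rewrite /pos_part (max_r (ltW gl)) subr0.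
    apply: (@le_trans _ _ (B ^+ 2 / L * Sg)); last by rewrite lerDr.
    move: lN; rewrite inE lD => /existsP[r /and3P[/eqP tl lS dis]].
    have sub : {subset S r <= free_coords} by move=> m mS; apply: free_coords_sub mS dis.
    have := typed_coord_ge tl lS sub (dg r); rewrite -/P0 => h.
    rewrite mulrAC ler_pdivlMr // mulNr lerNl (mulrC (g l)); apply: le_trans h.
    by rewrite lerN2 ler_wpM2l // sqr_ge0.
  case: (leP (g l) 0) => gl; first by rewrite subrr /pos_part max_r // subr0 addr_ge0.
  by rewrite sub0r /pos_part (max_l (ltW gl)) lerDr addr_ge0.
rewrite -subr_lt0 /pairing -sumrB.
have -> : \sum_i (weight i * g' i - weight i * g i) = \sum_i weight i * (g' i - g i).
  by apply: eq_bigr => l _; rewrite mulrBr.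
apply: le_lt_trans (ler_sum (index_enum 'I_n) (P := xpredT) (fun l _ => step l)) _.
rewrite sumrB -big_mkcond -/Sg sumr_const card_ord -[_ *+ n]mulr_natl mulrDr.
rewrite (_ : n%:R * (small_weight * (2 * B ^+ 2) * Sg) = 4^-1 * Sg); last by rewrite -wE; ring.
have h : n%:R * (B ^+ 2 / L * Sg) <= 4^-1 * Sg.
  rewrite mulrA ler_wpM2r ?(ltW Sg0) // mulrA ler_pdivrMr // -ler_pdivrMl ?invr_gt0 //.
  rewrite invrK; apply: le_trans (@L_ge 2 4 _ _ _) => //; last by rewrite ler_nat.
  by rewrite ler_wpM2l // ler_wpM2r // sqr_ge0.
lra.
Qed.

End Improvement.
End TypedCones.

(** * Leading coefficients of Hahn series *)

Section HahnLow.
Context {R : realType}.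
Implicit Types (x y : hahn R) (a b : R).

(** The exponent [a] need not belong to the support: the coefficient at [a] may vanish, which makes
    it compatible with sums and products. *)
Definition low a x := forall b, b < a -> x b = 0.

Lemma low_alpha_min x : low (alpha_min x) x.
Proof. by move=> b; exact: alpha_min_low. Qed.

Lemma low_le a b x : a <= b -> low b x -> low a x.
Proof. by move=> ab xb c ca; apply: xb; exact: lt_le_trans ab. Qed.

Lemma low_gt0 a x : low a x -> 0 < x a -> 0 < x.
Proof. by move=> lx x0; rewrite hahn_gt0 -/(hlead x) (hleadE lx) ?gt_eqF. Qed.

Lemma low_lt0 a x : low a x -> x a < 0 -> x < 0.
Proof.
move=> lx x0; rewrite -oppr_gt0; apply: (@low_gt0 a); last by rewrite hcoefN oppr_gt0.
by move=> b /lx xb; rewrite hcoefN xb oppr0.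
Qed.

Lemma low_ge0 a x : low a x -> 0 <= x -> 0 <= x a.
Proof.
by move=> lx; rewrite leNgt => x0; rewrite leNgt; apply: contra x0; exact: low_lt0.
Qed.

Lemma lowM a b x y : low a x -> low b y -> low (a + b) (x * y).
Proof.
move=> lx ly c cab; apply: contrapT => /eqP /supp_hmul[d dx [e ey de]].
have ad : a <= d by rewrite leNgt; apply: contra dx => /lx ->.
have be : b <= e by rewrite leNgt; apply: contra ey => /ly ->.
by move: cab; rewrite -de ltNge lerD.
Qed.

Lemma hcoefM_low a b x y : low a x -> low b y -> (x * y) (a + b) = x a * y b.
Proof.
move=> lx ly; rewrite (@hcoefME _ _ _ _ [set a]).
  by rewrite fsbig_set1 addrAC subrr add0r.
move=> c [cx cy] /=; apply/le_anti/andP; split; last first.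
  by rewrite leNgt; apply: contra cx => /lx ->.
rewrite leNgt; apply: contra cy => ac; rewrite ly // ltrBlDr addrC ltrD2l //.
Qed.

Lemma low_mono c a : low a (mono c a).
Proof. by move=> b ba; rewrite hcoef_mono lt_eqF. Qed.

Lemma low_sum (I : Type) (r : seq I) (Q : pred I) (F : I -> hahn R) a :
  (forall i, Q i -> low a (F i)) -> low a (\sum_(i <- r | Q i) F i).
Proof.
by move=> lF b ba; rewrite hcoef_sum big1 // => i /lF; exact.
Qed.

Lemma mono_gt0 c a : 0 < c -> 0 < mono c a.
Proof.
by move=> c0; apply: (@low_gt0 a); [exact: low_mono|rewrite hcoef_mono eqxx].
Qed.

Lemma hval_mono c a : 0 < c -> hval (mono c a) = (- a)%:E.
Proof.
move=> c0; rewrite /hval gt_eqF ?mono_gt0 //; congr (- _)%:E.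
apply: alpha_min_least; split.
  by rewrite /supp /= /mono_coef eqxx gt_eqF.
by move=> b; rewrite /supp /= /mono_coef; case: (eqVneq b a) => [->|_]; rewrite ?eqxx.
Qed.

End HahnLow.

(** * Residues of functionals and of conic combinations at a tropical point *)

Section Residues.
Context {R : realType} {n p : nat}.
Variables (v : 'I_p -> 'rV[R]_n) (C : 'I_p -> 'I_n -> R).
Hypothesis n_gt0 : (0 < n)%N.
Hypothesis C_gt0 : forall r i, 0 < C r i.
Implicit Types (f : 'rV[hahn R]_n) (y : 'rV[R]_n) (g z : 'I_n -> R).

Definition lifted r : 'rV[hahn R]_n := \row_i mono (C r i) (- v r 0 i).

(* The entries of g vanish at the terms f_i t^(-y_i) that are not dominant. *)
Definition residue y f g := exists2 m,
  forall i, low (m + y 0 i) (f 0 i) & forall i, g i = f 0 i (m + y 0 i).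

Lemma residue_exists y f : f != 0 ->
  exists2 g, residue y f g & exists k, g k != 0.
Proof.
move=> f0; have [i0 fi0] : exists i, f 0 i != 0.
  apply: contrapT => nf; case/eqP: f0; apply/rowP => i; rewrite mxE.
  by apply: contrapT => /eqP fi; apply: nf; exists i.
case: (@arg_minP _ _ _ i0 (fun i => f 0 i != 0)
  (fun i => alpha_min (f 0 i) - y 0 i) fi0) => k fk kmin.
set m := alpha_min (f 0 k) - y 0 k in kmin *.
exists (fun i => f 0 i (m + y 0 i)).
  exists m => // i; have [->//|fi] := eqVneq (f 0 i) 0.
  by apply: low_le (@low_alpha_min _ _); rewrite -lerBrDr kmin.
by exists k; rewrite /m subrK hlead_neq0.
Qed.

Lemma residueN y f g : residue y f g -> residue y (- f) (fun i => - g i).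
Proof.
move=> [m lf gE]; exists m => i; last by rewrite mxE hcoefN gE.
by move=> b /lf fb; rewrite mxE hcoefN fb oppr0.
Qed.

Definition top_coef y r i : R := if i \in tops v y r then C r i else 0.

Lemma tops_max y r : exists2 M, forall i, v r 0 i - y 0 i <= M &
  forall i, i \in tops v y r <-> v r 0 i - y 0 i = M.
Proof.
case: (@arg_maxP _ _ _ (Ordinal n_gt0) xpredT (fun i => v r 0 i - y 0 i) isT) => k _ kmax.
exists (v r 0 k - y 0 k) => i; first exact: kmax.
split=> [/topsP h|ik]; last by apply/topsP => l; rewrite ik; exact: kmax.
by apply/le_anti; rewrite h andbT; exact: kmax.
Qed.

(** With M the maximum of v^r - y, no term of the pairing has an exponent below m - M, and the
    coefficient there is the real pairing. *)
Lemma residue_lifted y f g r : residue y f g -> 0 <= dot f (lifted r) ->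
  0 <= pairing (top_coef y r) g.
Proof.
move=> [m lf gE] f0; have [M Mmax Mtop] := tops_max y r.
have lt i : low (m - M) (f 0 i * lifted r 0 i).
  rewrite mxE; apply: (@low_le _ _ (m + y 0 i - v r 0 i)).
    by have := Mmax i; lra.
  by apply: lowM; [exact: lf|exact: low_mono].
have := low_ge0 (low_sum _ (fun i _ => lt i)) f0; rewrite hcoef_sum.
suff -> : \sum_i (f 0 i * lifted r 0 i) (m - M) = pairing (top_coef y r) g by [].
apply: eq_bigr => i _; rewrite /top_coef mxE mulrC hcoef_monoM opprK.
case: (boolP (i \in _)) => [/Mtop <-|/negP iM]; last first.
  rewrite mul0r lf ?mulr0 //; have : v r 0 i - y 0 i < M.
    by rewrite lt_neqAle Mmax andbT; apply/eqP => /Mtop.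
  lra.
by rewrite gE; congr (_ * hcoef _ _); ring.
Qed.

Definition real_point y z : 'rV[hahn R]_n := \row_i mono (z i) (- y 0 i).

Lemma residue_real_point y f g z : residue y f g -> 0 < pairing z g ->
  0 < dot f (real_point y z).
Proof.
move=> [m lf gE] zg; apply: (@low_gt0 _ m).
  apply: low_sum => i _; rewrite mxE -[m](addrK (y 0 i)).
  by apply: lowM; [exact: lf|exact: low_mono].
rewrite hcoef_sum; apply: lt_le_trans zg _; rewrite le_eqVlt; apply/orP; left.
apply/eqP/eq_bigr => i _.
by rewrite mxE [in RHS]mulrC hcoef_monoM opprK gE.
Qed.

(** All entries are nonnegative, so leading terms cannot cancel: the leading coefficients of a conic
    combination form a conic combination of the vectors [top_coef y r]. *)
Lemma cone_real_point y z g : cone lifted (real_point y z) ->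
  real_dual (top_coef y) g -> 0 <= pairing z g.
Proof.
move=> [a a0 zE] dg.
have zEi i : real_point y z 0 i = \sum_r a r * lifted r 0 i.
  by rewrite zE summxE; apply: eq_bigr => r _; rewrite mxE.
have l0 r i : 0 <= lifted r 0 i by rewrite mxE ltW ?mono_gt0.
(* A lower exponent in [a r] would make its contribution alone exceed the [i]-th entry of the
   point. *)
have a_low r M : (exists2 i, i \in tops v y r & v r 0 i - y 0 i = M) -> low M (a r).
  move=> [i itop <-]; have [->//|ar] := eqVneq (a r) 0.
  apply: low_le (@low_alpha_min _ _); rewrite leNgt; apply/negP => aM.
  have : 0 <= real_point y z 0 i - a r * lifted r 0 i.
    rewrite zEi (bigD1 r) //= addrC addrK; apply: sumr_ge0 => s _.
    by rewrite mulr_ge0.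
  apply/negP; rewrite -ltNge; apply: (@low_lt0 _ (alpha_min (a r) - v r 0 i)).
    move=> b bl; rewrite hcoefB !mxE mulrC hcoef_monoM opprK hcoef_mono.
    rewrite alpha_min_low ?mulr0 ?subr0; last by lra.
    by rewrite ifF //; apply/lt_eqF; lra.
  rewrite hcoefB !mxE mulrC hcoef_monoM opprK hcoef_mono subrK ifF; last first.
    by apply/lt_eqF; lra.
  rewrite sub0r oppr_lt0 mulr_gt0 // -hahn_gt0 lt_def ar a0 //.
(* The value is the same for every choice of [i] in the support, which is nonempty. *)
pose al r := if [pick i in tops v y r] is Some i then a r (v r 0 i - y 0 i) else 0.
have al0 r : 0 <= al r.
  rewrite /al; case: pickP => // i itop; apply: low_ge0 => //.
  by apply: a_low; exists i.
have zi i : z i = \sum_r al r * top_coef y r i.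
  have : real_point y z 0 i (- y 0 i) = z i by rewrite mxE hcoef_mono eqxx.
  rewrite zEi hcoef_sum => <-; apply: eq_bigr => r _.
  rewrite mxE mulrC hcoef_monoM opprK /al /top_coef addrC.
  have [M Mmax Mtop] := tops_max y r.
  case: (boolP (i \in tops v y r)) => [itop|/negP iM].
    have iM := (Mtop i).1 itop.
    case: pickP => [k /Mtop kM|/(_ i)]; last by rewrite itop.
    by rewrite iM kM mulrC.
  have [k ktop] : exists k, k \in tops v y r.
    case: (@arg_maxP _ _ _ (Ordinal n_gt0) xpredT (fun i => v r 0 i - y 0 i) isT) => k _ kmax.
    by exists k; apply/topsP => l; exact: kmax.
  rewrite mulr0 (@a_low r M) ?mulr0 //; first by exists k => //; apply/Mtop.
  by rewrite lt_neqAle Mmax andbT; apply/eqP => /Mtop.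
rewrite /pairing; under eq_bigr => i _ do rewrite zi mulr_suml.
rewrite exchange_big /=; apply: sumr_ge0 => r _.
under eq_bigr => i _ do rewrite -mulrA.
by rewrite -mulr_sumr mulr_ge0 //; exact: dg.
Qed.

(** At the exponent m - T only the coordinates where x - y equals T contribute, with the signs of
    [g] because the leading coefficients of [X] are positive. *)
Lemma residue_separates y f g (x : 'rV[R]_n) (X : 'rV[hahn R]_n) T j :
  residue y f g ->
  (forall i, 0 < X 0 i /\ hval (X 0 i) = (x 0 i)%:E) ->
  (forall i, x 0 i - y 0 i <= T) ->
  (forall i, x 0 i - y 0 i = T -> g i <= 0) ->
  x 0 j - y 0 j = T -> g j < 0 -> dot f X < 0.
Proof.
move=> [m lf gE] HX xT gT jT gj.
have HXl i : low (- x 0 i) (X 0 i) /\ 0 < X 0 i (- x 0 i).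
  have [X0] := HX i; rewrite /hval gt_eqF // => -[<-]; rewrite opprK.
  by split; [exact: low_alpha_min|rewrite -hahn_gt0].
have lfX i : low (m + y 0 i - x 0 i) (f 0 i * X 0 i).
  by apply: lowM; [exact: lf|have [] := HXl i].
apply: (@low_lt0 _ (m - T)).
  by apply: low_sum => i _; apply: low_le (lfX i); have := xT i; lra.
have term i : (f 0 i * X 0 i) (m - T) <= 0.
  have [iT|/eqP iT] := eqVneq (x 0 i - y 0 i) T; last first.
    by rewrite (lfX i) //; have := xT i; rewrite le_eqVlt => /predU1P[/iT []|]; lra.
  have -> : m - T = m + y 0 i + - x 0 i by lra.
  have [lX X0] := HXl i; rewrite (hcoefM_low (lf i) lX) -gE.
  by rewrite pmulr_lle0 // gT.
rewrite /dot hcoef_sum (bigD1 j) //; rewrite -[ltRHS]addr0.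
apply: ltr_leD; last by apply: sumr_le0 => i _; exact: term.
have -> : m - T = m + y 0 j + - x 0 j by lra.
have [lX X0] := HXl j; rewrite (hcoefM_low (lf j) lX) -gE.
by rewrite pmulr_llt0.
Qed.

End Residues.

(** * A facet separating a point from the polytope *)

Section SeparatingFacet.
Context {R : realType} {n p : nat}.
Variables (v : 'I_p -> 'rV[R]_n) (b : 'I_p -> 'I_n -> R) (B L : R).
Hypotheses (n_gt0 : (0 < n)%N) (p_gt0 : (0 < p)%N).
Hypothesis v_pure : pure (tropical_polytope v).
Hypothesis B1 : 1 <= B.
Hypothesis LB : 16 * n%:R ^+ 2 * B ^+ 8 <= L.
Hypothesis b_bounds : forall r i, 1 <= B * b r i /\ b r i <= B.
Local Notation P := (tropical_polytope v).

(** With [L] equal to 1/mu and [b] to the powers of nu these are the coefficients of the perturbed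
    lift, by [lift_vectorsE]. *)
Definition typed_coef r i : R := if gen_type v r == Some i then L * b r i else b r i.
Local Notation V := (lifted v typed_coef).
Local Notation tc := (top_coef v typed_coef).
Local Notation wB := (small_weight (n := n) B).

Let B0 : 0 < B. Proof. exact: lt_le_trans B1. Qed.
Let L0 : 0 < L.
Proof.
apply: lt_le_trans LB; rewrite !mulr_gt0 ?exprn_gt0 //; by rewrite ltr0n.
Qed.
Let b0 r i : 0 < b r i.
Proof.
rewrite -(pmulr_rgt0 _ B0); apply: lt_le_trans (b_bounds r i).1; exact: ltr01.
Qed.

Lemma typed_coef_gt0 r i : 0 < typed_coef r i.
Proof. by rewrite /typed_coef; case: ifP => _; rewrite // mulr_gt0. Qed.

Section AtPoint.
Variable y : 'rV[R]_n.
Hypothesis Py : P (tproj y).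

Let c_out r i : i \notin tops v y r -> tc y r i = 0.
Proof. by rewrite /top_coef => /negPf->. Qed.
Let c_untyped r i : i \in tops v y r -> gen_type v r != Some i ->
  1 <= B * tc y r i /\ tc y r i <= B.
Proof. by rewrite /top_coef /typed_coef => -> /negPf->. Qed.
Let c_typed r i : i \in tops v y r -> gen_type v r = Some i ->
  L <= B * tc y r i /\ tc y r i <= L * B.
Proof.
rewrite /top_coef /typed_coef => -> ->; rewrite eqxx.
have [h1 h2] := b_bounds r i; split; last by rewrite ler_wpM2l // ltW.
by rewrite mulrCA ler_peMr // ltW.
Qed.
Let cover k : exists r, k \in tops v y r. Proof. exact: tops_cover. Qed.

Lemma objective_pos Y g : (forall i, wB <= Y i <= 1) -> real_dual (tc y) g ->
  (exists k, g k != 0) -> 0 < pairing Y g.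
Proof.
exact: (objective_gt0 n_gt0 B1 LB c_out c_untyped c_typed
  (fun r k => tops_typed v_pure) cover).
Qed.

Lemma small_weight_le1 : wB <= 1.
Proof.
have /andP[h1 h2] := @weight_bounds R n B n_gt0 B1 finset.set0 (Ordinal n_gt0).
exact: le_trans h1 h2.
Qed.

(** If no listed normal is suitable, a real number [lam] is found such that the lift of
    [Yv + lam e_j] satisfies all facet inequalities and thus lies in the cone, while a real dual
    functional [g'] is negative on its leading coefficients. This contradicts [cone_real_point]. *)
Lemma exists_separating_facet (D : {set 'I_n}) j (s : seq 'rV[hahn R]_n) :
  (forall r, exists2 i, i \in D & i \in tops v y r) -> j \notin D ->
  {in s, forall f, facet_normal V f} ->
  (forall f, facet_normal V f -> exists2 f', f' \in s & exists2 a, 0 < a & f' = a *: f) ->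
  spanning V ->
  exists2 f, f \in s & exists g, [/\ residue y f g, g j < 0 &
    forall k, k \notin D -> g k <= 0].
Proof.
move=> hitD jD sF sall spV.
pose Q (A : {set 'I_n}) := [forall r, (gen_type v r == Some j) && (j \in tops v y r) ==>
  [exists i, (i \in A) && (i \in tops v y r)]].
have QD : Q D.
  apply/forallP => r; apply/implyP => _; have [i iD ir] := hitD r.
  by apply/existsP; exists i; rewrite iD.
have [D0 /minsetP[QD0 D0min] D0D] := minset_exists QD.
have jD0 : j \notin D0 by apply: contra jD => /(fintype.subsetP D0D).
have hit r : gen_type v r = Some j -> j \in tops v y r ->
    exists2 i, i \in D0 & i \in tops v y r.
  move=> tr jr; move/forallP/(_ r): QD0; rewrite tr jr eqxx /=.
  by move=> /existsP[i /andP[? ?]]; exists i.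
have min_hit i : i \in D0 -> exists r, [/\ gen_type v r = Some j, j \in tops v y r
    & forall l, l \in D0 -> l \in tops v y r -> l = i].
  (* By minimality, removing [i] from [D0] leaves some generator of type [j] unhit. *)
  move=> iD0; have : ~~ Q (D0 :\ i)%SET.
    apply/negP => Qi; have := D0min _ Qi (subD1set _ _).
    by move=> /setP/(_ i); rewrite !inE eqxx iD0.
  move=> /forallPn[r]; rewrite negb_imply => /andP[/andP[/eqP tr jr] /existsPn nr].
  exists r; split=> // l lD0 lr; apply/eqP; have := nr l.
  by rewrite finset.in_setD1 lD0 lr !andbT negbK.
pose Yv := weight B D0.
have Yb i : wB <= Yv i <= 1 by exact: (@weight_bounds R n B n_gt0 B1).
have dualg f g : f \in s -> residue y f g -> real_dual (tc y) g.
  by move=> /sF[_ df _] fg r; apply: residue_lifted fg (df r).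
apply: contrapT => none.
have bad f g : f \in s -> residue y f g -> g j < 0 -> exists2 k, k \notin D0 & 0 < g k.
  move=> fs fg gj; apply: contrapT => nk; apply: none; exists f => //; exists g.
  split=> // k kD; rewrite leNgt; apply/negP => gk; apply: nk; exists k => //.
  by apply: contra kD => /(fintype.subsetP D0D).
pose cond lam f := exists g,
  [/\ residue y f g, exists k, g k != 0 & 0 < pairing Yv g + lam * g j].
(* Induction on the list of normals: [lam] starts just above the objective of [feasible_dual] and is
   lowered whenever the next normal violates its inequality. *)
have [lam [g' [dg' g'j g'lam sc]]] : exists lam g', [/\ real_dual (tc y) g', g' j = -1,
    pairing Yv g' < lam & {in s, forall f, cond lam f}].
  have : {subset s <= s} by [].
  elim: {-2}s => [_|f s' IH fs].
    exists (pairing Yv (feasible_dual B L D0 j) + 1), (feasible_dual B L D0 j); split=> //.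
    - exact: (real_dual_feasible n_gt0 B1 LB c_out c_untyped c_typed
        (fun r k => tops_typed v_pure)).
    - exact: feasible_dual_j.
    - by rewrite ltrDl.
  have s's : {subset s' <= s} by move=> h hs'; apply: fs; rewrite inE hs' orbT.
  have {}fs : f \in s by apply: fs; rewrite inE eqxx.
  have [lam [g' [dg' g'j g'lam sc]]] := IH s's.
  have nz (g : 'I_n -> R) : g j = -1 -> exists k, g k != 0.
    by move=> gj; exists j; rewrite gj oppr_eq0 oner_eq0.
  have lam0 : 0 < lam by apply: lt_trans g'lam; apply: objective_pos => //; exact: nz.
  have [f0 _ _] := sF f fs.
  have [g fg gnz] := residue_exists y f0.
  have dg := dualg _ _ fs fg.
  have phig := objective_pos Yb dg gnz.
  have [pos|npos] := ltP 0 (pairing Yv g + lam * g j).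
    exists lam, g'; split=> // h; rewrite inE => /predU1P[->|]; last exact: sc.
    by exists g.
  have gj : g j < 0.
    rewrite -(pmulr_rlt0 _ lam0); apply: lt_le_trans npos.
    by rewrite ltrDr.
  have gj' : 0 < - g j by rewrite oppr_gt0.
  (* The residue normalized to -1 at [j]; being positive somewhere outside [D0], it admits a strict
     improvement [g'']. *)
  pose h k := (- g j)^-1 * g k.
  have hE u : pairing u h = (- g j)^-1 * pairing u g.
    by rewrite /pairing mulr_sumr; apply: eq_bigr => k _; rewrite /h mulrCA.
  have dh : real_dual (tc y) h.
    by move=> r; rewrite hE mulr_ge0 ?dg // invr_ge0 ltW.
  have hj : h j = -1 by rewrite /h invrN mulNr mulVf // lt_eqF.
  have [k kD0 gk] := bad _ _ fs fg gj.
  have hk : 0 < h k by rewrite /h mulr_gt0 // invr_gt0.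
  have [g'' [dg'' g''j g''h]] := dual_improvement n_gt0 B1 LB c_out c_untyped c_typed
    (fun r k => tops_typed v_pure) cover jD0 hit min_hit dh hj kD0 hk.
  have hlam : pairing Yv h <= lam.
    rewrite hE mulrC ler_pdivrMr // mulrN; lra.
  have g''pos : 0 < pairing Yv g'' by apply: objective_pos => //; exact: nz.
  (* Below the objective of [h], so the new normal becomes positive; above that of [g''], which
     replaces [g']. As [lam'] is below [lam], the normals treated earlier remain positive. *)
  pose lam' := (pairing Yv g'' + pairing Yv h) / 2.
  have g''h' : pairing Yv g'' < pairing Yv h by [].
  have lam'h : lam' < pairing Yv h by rewrite /lam'; lra.
  have g''lam' : pairing Yv g'' < lam' by rewrite /lam'; lra.
  exists lam', g''; split=> // f1; rewrite inE => /predU1P[->|f1s'].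
    exists g; split=> //.
    have -> : pairing Yv g = - g j * pairing Yv h by rewrite hE mulVKf // gt_eqF.
    have : 0 < - g j * (pairing Yv h - lam') by rewrite mulr_gt0 // subr_gt0.
    by rewrite mulrBr !mulNr opprK [g j * lam']mulrC.
  have [g1 [f1g1 g1nz g1pos]] := sc _ f1s'.
  exists g1; split=> //.
  have [g1j|g1j] := leP 0 (g1 j).
    have phi1 := objective_pos Yb (dualg _ _ (s's _ f1s') f1g1) g1nz.
    by rewrite ltr_pwDl // mulr_ge0 // (le_trans (ltW g''pos)) // ltW.
  apply: lt_le_trans g1pos _; rewrite lerD2l ler_wnM2r ?(ltW g1j) //.
  by rewrite ltW // (lt_le_trans lam'h).
pose z i := Yv i + (if i == j then lam else 0).
have zE g : pairing z g = pairing Yv g + lam * g j.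
  rewrite /pairing /z; under eq_bigr => i _ do rewrite mulrDl.
  rewrite big_split /=; congr (_ + _); rewrite (bigD1 j) //= eqxx big1 ?addr0 //.
  by move=> i /negPf->; rewrite mul0r.
have inc : cone V (real_point y z).
  apply: contrapT => /(facet_separation spV)[f /sall[f' f's [a a0 f'E]] fz].
  have [g [f'g _ pos]] := sc _ f's.
  rewrite -zE in pos; have := residue_real_point f'g pos.
  by rewrite f'E dotZl pmulr_rgt0 // ltNge ltW.
have := cone_real_point n_gt0 typed_coef_gt0 inc dg'.
by rewrite zE g'j mulrN1 subr_ge0 leNgt g'lam.
Qed.

End AtPoint.

(** If [h] annihilates all generators, a residue of [h] and its opposite are both dual, so both
    would have a positive objective. *)
Lemma lifted_spanning : spanning V.
Proof.
move=> h hV; apply: contrapT => /eqP h0.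
pose y := v (Ordinal p_gt0).
have Py : P (tproj y) by exact: polytope_gen.
have [g hg gnz] := residue_exists y h0.
pose one (i : 'I_n) : R := 1.
have one_w i : wB <= one i <= 1 by rewrite lexx small_weight_le1.
have pos1 : 0 < pairing one g.
  apply: (objective_pos Py one_w) => // r.
  by apply: (residue_lifted _ hg) => //; rewrite hV.
have : 0 < pairing one (fun i => - g i).
  apply: (objective_pos Py one_w) => [r|].
    apply: (residue_lifted _ (residueN hg)) => //.
    by rewrite -scaleN1r dotZl hV mulr0.
  by have [k gk] := gnz; exists k; rewrite oppr_eq0.
rewrite /pairing; under eq_bigr => i _ do rewrite mulrN.
by rewrite sumrN oppr_gt0 ltNge ltW.
Qed.

Lemma separating_facet (x : 'rV[R]_n) : ~ P (tproj x) ->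
  exists2 f, facet_normal V f & forall (x' : 'rV[R]_n) (X : 'rV[hahn R]_n),
    tproj x = tproj x' ->
    (forall i, 0 < X 0 i /\ hval (X 0 i) = (x' 0 i)%:E) -> dot f X < 0.
Proof.
move=> nPx; pose i0 := Ordinal n_gt0; pose lam r := lam_proj v x r i0.
have ymax i : exists r, forall s, lam s + v s 0 i <= lam r + v r 0 i.
  case: (@arg_maxP _ _ _ (Ordinal p_gt0) xpredT (fun r => lam r + v r 0 i) isT) => r _ rmax.
  by exists r => s; exact: rmax.
have /choice[rr rrP] := ymax.
pose y : 'rV[R]_n := \row_i (lam (rr i) + v (rr i) 0 i).
have yE i : y 0 i = lam (rr i) + v (rr i) 0 i by rewrite mxE.
have Py : P (tproj y).
  apply/polytopeP => //; exists lam; split=> i; last by exists (rr i); rewrite yE.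
  by move=> r; rewrite yE.
have yx i : y 0 i <= x 0 i by rewrite yE; have [h _] := lam_projP v x (rr i) i0.
case: (@arg_maxP _ _ _ i0 xpredT (fun i => x 0 i - y 0 i) isT) => j _ jmax.
set T := x 0 j - y 0 j in jmax.
have {}jmax i : x 0 i - y 0 i <= T by exact: jmax.
have T0 : 0 < T.
  rewrite lt_neqAle subr_ge0 yx andbT; apply/eqP => T0; apply: nPx.
  suff -> : x = y by [].
  apply/rowP => i; apply/le_anti; rewrite yx andbT.
  by rewrite -subr_le0 T0.
pose D : {set 'I_n} := [set i | x 0 i - y 0 i < T]%SET.
(* The translate of [v r] by [lam r] touches [x] at some [i]. There [y] and [x] agree, so [i] is in
   the support, and it is in [D] because T is positive. *)
have hitD r : exists2 i, i \in D & i \in tops v y r.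
  have [h [i iE]] := lam_projP v x r i0; rewrite -/(lam r) in h iE.
  have ly l : lam r + v r 0 l <= y 0 l by rewrite yE.
  have yi : y 0 i = x 0 i by apply/le_anti; rewrite yx -iE ly.
  exists i; first by rewrite inE yi subrr.
  by apply/topsP => l; have := ly l; rewrite yi; lra.
have jD : j \notin D by rewrite inE ltxx.
have [s sF sall] := facet_normal_list lifted_spanning.
have [f fs [g [fg gj gD]]] := exists_separating_facet Py hitD jD sF sall lifted_spanning.
exists f; first exact: sF.
move=> x' X /tprojP[c x'E] HX.
have x'y i : x' 0 i - y 0 i = x 0 i - y 0 i + c by rewrite x'E !mxE addrAC.
apply: (residue_separates fg HX (T := T + c) (j := j)) => // i; rewrite x'y.
  by rewrite lerD2r.
by move=> /addIr iT; apply: gD; rewrite inE iT ltxx.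
Qed.

End SeparatingFacet.

(** * Maximal minors *)

Section Minors.
Context {R : realType}.

Lemma near_right0P (Q : R -> Prop) : (\forall x \near 0^'+, Q x) <->
  exists2 e : R, 0 < e & forall x, 0 < x < e -> Q x.
Proof.
split=> [/nbhs_ballP[e /= e0 eQ]|[e e0 eQ]].
  exists e => // x /andP[x0 xe]; apply: eQ => //.
  by rewrite /ball /= sub0r normrN gtr0_norm.
near=> x; apply: eQ; apply/andP; split; near: x.
- exact: nbhs_right_gt.
- exact: nbhs_right_lt.
Unshelve. all: by end_near. Qed.

Lemma mono_prod (I : finType) (c a : I -> R) :
  \prod_i mono (c i) (a i) = mono (\prod_i c i) (\sum_i a i).
Proof.
rewrite unlock /=; elim: (index_enum I) => [|i s /= ->]; first by rewrite mono10.
by rewrite mono_mul.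
Qed.

Lemma prod_powR (I : finType) (a : R) (x : I -> R) : 0 < a ->
  \prod_i a `^ x i = a `^ (\sum_i x i).
Proof.
move=> a0; rewrite (big_morph (powR a) (id1 := 1) (op1 := *%R)) ?powRr0 //.
by move=> y z; rewrite powRD // (gt_eqF a0) implybT.
Qed.

Lemma powR_small (d e : R) : 0 < d -> 0 < e -> \forall x \near 0^'+, x `^ d < e.
Proof.
move=> d0 e0; apply/near_right0P; exists (e `^ d^-1); first exact: powR_gt0.
move=> x /andP[x0 xe]; rewrite -[ltRHS](powRr1 (ltW e0)) -(mulVf (lt0r_neq0 d0)) powRrM.
by rewrite gt0_ltr_powR // nnegrE ?powR_ge0 // ltW.
Qed.

Lemma poly_nonzero_large (q : {poly R}) : q != 0 ->
  \forall mu \near 0^'+, q.[mu^-1] != 0.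
Proof.
move=> q0; apply/near_right0P; exists (`|cauchy_bound q| + 1)^-1.
  by rewrite invr_gt0 ltr_wpDl.
move=> mu /andP[mu0]; rewrite -{1}[mu]invrK ltf_pV2 ?posrE ?invr_gt0 ?ltr_wpDl // => mul.
apply/eqP => /(cauchy_boundP q0); apply/negP; rewrite -leNgt gtr0_norm ?invr_gt0 //.
by apply: le_trans (ler_norm _) _; apply: le_trans (ltW mul); rewrite lerDl.
Qed.

(* The maximal permutation s0 of g has no competitor in the coefficient of
   t^(- weight of s0), which is a polynomial in mu^-1. *)
Lemma minor_neq0 m (W G : 'M[R]_m) (d : 'I_m -> 'I_m -> bool) :
  ~ tropically_singular G ->
  \forall nu \near 0^'+, \forall mu \near 0^'+,
    \det (\matrix_(i, j) mono (mu^-1 ^+ d i j * nu `^ (- G i j)) (- W i j)) != 0.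
Proof.
move=> nsG.
case: (@arg_maxP _ _ _ (1%g : 'S_m) xpredT (perm_weight G) isT) => s0 _ s0max.
have {}s0max s : perm_weight G s <= perm_weight G s0 by exact: s0max.
have s0lt s : s != s0 -> perm_weight G s < perm_weight G s0.
  move=> ss0; rewrite lt_neqAle s0max andbT; apply/eqP => sE.
  apply: nsG; exists s, s0; split=> // u; rewrite sE; exact: s0max.
pose N : R := #|{: 'S_m}|%:R.
have N0 : 0 < N by rewrite ltr0n; apply/card_gt0P; exists 1%g.
(* For small nu every permutation other than [s0] has less than 1/N times the nu-factor of [s0],
   where N is the number of permutations. *)
have H1 : \forall nu \near 0^'+, forall s, s != s0 ->
    nu `^ (perm_weight G s0 - perm_weight G s) < N^-1.
  apply: filter_forall => s; have [->|/s0lt ss0] := eqVneq s s0.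
    by apply: nearW => nu.
  have : \forall nu \near 0^'+, nu `^ (perm_weight G s0 - perm_weight G s) < N^-1.
    by apply: powR_small; rewrite ?subr_gt0 ?invr_gt0.
  by apply: filterS.
near=> nu.
have nu0 : 0 < nu by near: nu; exact: nbhs_right_gt.
have H1nu : forall s, s != s0 -> nu `^ (perm_weight G s0 - perm_weight G s) < N^-1.
  by near: nu; exact: H1.
pose a (s : 'S_m) : nat := (\sum_i d i (s i))%N.
pose e s : R := nu `^ (- perm_weight G s).
pose top s := perm_weight W s == perm_weight W s0.
(* The coefficient of the determinant at the exponent [- perm_weight W s0], as a polynomial in
   1/mu. *)
pose q : {poly R} := \sum_(s | top s) ((-1) ^+ s * e s) *: 'X^(a s).
have q0 : q != 0.
  apply/eqP => /(congr1 (fun q : {poly R} => q`_(a s0))); rewrite coef0 coef_sum.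
  rewrite (bigD1 s0) ?coefZ ?coefXn; last exact: eqxx.
  rewrite eqxx mulr1 => /eqP; rewrite addr_eq0 => /eqP E.
  (* If the coefficient of [q] at degree [a s0] vanished, the other permutations would cancel
     [e s0]; but they are N - 1 terms of size at most [e s0] / N. *)
  have : e s0 <= \sum_(s | top s && (s != s0)) e s.
    have -> : e s0 = `|(-1) ^+ s0 * e s0|.
      by rewrite normrM normrX normrN1 expr1n mul1r ger0_norm ?powR_ge0.
    rewrite E normrN (le_trans (ler_norm_sum _ _ _)) // ler_sum // => s _.
    rewrite coefZ coefXn !normrM normrX normrN1 expr1n mul1r ger0_norm ?powR_ge0 //.
    by case: (_ == _); rewrite ?normr1 ?normr0 ?mulr1 ?mulr0 ?powR_ge0.
  apply/negP; rewrite -ltNge.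
  have e0 s : 0 < e s by exact: powR_gt0.
  have eN s : s != s0 -> e s <= e s0 * N^-1.
    move=> ss0; apply: (@le_trans _ _ (e s0 * nu `^ (perm_weight G s0 - perm_weight G s))).
      by rewrite /e -powRD ?(gt_eqF nu0) ?implybT // addrA addNr add0r.
    by rewrite ler_wpM2l ?(ltW (e0 _)) // ltW // H1nu.
  apply: (@le_lt_trans _ _ (\sum_(s | s != s0) e s0 * N^-1)).
    rewrite [leLHS]big_mkcond [leRHS]big_mkcond; apply: ler_sum => s _.
    case: (boolP (s != s0)) => ss0; rewrite ?andbF ?andbT //.
    by case: (top s); [exact: eN|rewrite mulr_ge0 ?invr_ge0 ?ltW].
  have : \sum_(s : 'S_m) e s0 * N^-1 = e s0.
    by rewrite sumr_const -[_ *+ _]mulr_natr -mulrA mulVf ?mulr1 // gt_eqF.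
  rewrite (bigD1 s0) //= => {2}<-; rewrite ltrDr mulr_gt0 ?invr_gt0 //.
have := poly_nonzero_large q0; apply: filterS => mu; apply: contra => /eqP D0.
have : (\det (\matrix_(i, j) mono (mu^-1 ^+ d i j * nu `^ (- G i j)) (- W i j)))
    (- perm_weight W s0) = 0 by rewrite D0.
rewrite /determinant hcoef_sum => sum0; rewrite /q horner_sum -[eqbRHS]sum0.
apply/eqP; rewrite big_mkcond; apply: eq_bigr => s _.
under [X in hcoef (_ * X)]eq_bigr => i _ do rewrite mxE.
rewrite mono_prod big_split prod_powR // -(big_morph _ (exprD _) (expr0 _)).
rewrite !sumrN -/(perm_weight G s) -/(perm_weight W s) -/(a s) -/(e s).
rewrite hornerZ hornerXn !mulr_sign.
case: (odd_perm s); rewrite ?hcoefN hcoef_mono eqr_opp eq_sym /top; case: ifP => _.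
- by rewrite mulNr; congr (- _); exact: mulrC.
- by rewrite oppr0.
- exact: mulrC.
- by [].
Unshelve. all: by end_near. Qed.

Lemma increasing_enum p m (A : {set 'I_p}) : (m <= #|A|)%N ->
  exists2 h : 'I_m -> 'I_p, {homo h : i j / (i < j)%N} & forall i, h i \in A.
Proof.
move=> mA; exists (fun i => enum_val (widen_ord mA i)) => [i j ij|i]; last exact: enum_valP.
pose h0 (k : 'I_m) := enum_val (widen_ord mA k).
have srt : sorted ltn (map val (enum A)).
  apply: (subseq_sorted ltn_trans _ (iota_ltn_sorted 0 p)); rewrite -val_enum_ord.
  by rewrite {1}/enum_mem map_subseq // enumT filter_subseq.
have sz k : (k < m)%N -> k \in [pred k | (k < size (map val (enum A)))%N].
  by move=> km; rewrite inE size_map -cardE (leq_trans km).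
have := sorted_ltn_nth ltn_trans 0%N srt _ _ (sz _ (ltn_ord i)) (sz _ (ltn_ord j)) ij.
rewrite !(nth_map (h0 i)) -?cardE; try exact: leq_trans (ltn_ord _) mA.
by rewrite !(enum_val_nth (h0 i) (widen_ord _ _)).
Qed.

(** The rank condition provides n - 1 tight generators. If [f] vanished at [i], its other entries
    would form a nonzero kernel vector of the minor of these generators without coordinate [i]. *)
Lemma facet_normal_neq0 (K : realFieldType) n p (V : 'I_p -> 'rV[K]_n) f i :
  (forall (k : 'I_n) (h : 'I_n.-1 -> 'I_p), {homo h : a b / (a < b)%N} ->
    \det (\matrix_(a, b) V (h b) 0 (lift k a)) != 0) ->
  facet_normal V f -> f 0 i != 0.
Proof.
move=> minors [f0 _ rk]; apply/eqP => fi.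
have card_tight : (n.-1 <= #|tight V f|)%N.
  rewrite -rk; set T := tight V f.
  pose M : 'M[K]_(#|T|, n) := \matrix_k V (enum_val k).
  apply: leq_trans (rank_leq_row M); apply: mxrankS; apply/row_subP => r.
  rewrite row_rows; case: ifP => rT; last exact: sub0mx.
  by rewrite -(enum_rankK_in rT rT) -(rowK (fun k => V (enum_val k))) row_sub.
have [h hmono hT] := increasing_enum card_tight.
have /eqP := minors i h hmono; apply; apply/eqP.
apply/det0P; exists (\row_a f 0 (lift i a)) => [|].
  apply: contra f0 => /eqP/rowP z; apply/eqP/rowP => k; rewrite mxE.
  by case: (unliftP i k) => [a ->|->//]; have := z a; rewrite !mxE.
apply/rowP => b; rewrite [RHS]mxE mxE.
have := hT b; rewrite inE => /eqP; rewrite /dot (bigD1_ord i) //= fi mul0r add0r => hb.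
by rewrite -[RHS]hb; apply: eq_bigr => a _; rewrite !mxE.
Qed.

End Minors.

(** * Images of facet-defining half-spaces *)

Section HalfspaceImage.
Context {R : realType} {n : nat}.
Implicit Types (f : 'rV[hahn R]_n) (x : 'rV[R]_n).

(** If the negative terms dominate at [x], [residue_separates] makes every lift of [x] violate the
    inequality. Otherwise a positive term is among the dominant ones, and a lift with large leading
    coefficients on [I] satisfies it. *)
Lemma val_image_halfspace f : (forall i, f 0 i != 0) ->
  (exists i, 0 < f 0 i) -> (exists i, f 0 i < 0) ->
  val_image (halfspace f) =
  tropical_halfspace (\row_i alpha_min (f 0 i)) [set i | 0 < f 0 i]%SET.
Proof.
move=> fn0 [i0 fi0] [j0 fj0]; set a := \row_i _; set I := [set i | _]%SET.
have i0I : i0 \in I by rewrite inE.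
have j0I : j0 \in (~: I)%SET by rewrite !inE -leNgt ltW.
have lf i : low (a 0 i) (f 0 i) by rewrite mxE; exact: low_alpha_min.
have fI i : i \in I -> 0 < f 0 i (a 0 i) by rewrite inE mxE -hahn_gt0.
have fJ i : i \in (~: I)%SET -> f 0 i (a 0 i) < 0.
  rewrite !inE -leNgt => fi; have : 0 < - f 0 i by rewrite oppr_gt0 lt_neqAle fn0.
  by rewrite hahn_gt0 -/(hlead _) hleadN oppr_gt0 mxE.
have maxI x : exists2 b, (\big[maxe/-oo]_(i in I) (x 0 i - a 0 i)%:E = b%:E)%E &
    (forall i, i \in I -> x 0 i - a 0 i <= b) /\ exists2 i, i \in I & x 0 i - a 0 i = b.
  case: (@arg_maxP _ _ _ i0 (mem I) (fun i => x 0 i - a 0 i) i0I) => k kI kmax.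
  have H : (forall i, i \in I -> x 0 i - a 0 i <= x 0 k - a 0 k) /\
      exists2 i, i \in I & x 0 i - a 0 i = x 0 k - a 0 k by split=> //; exists k.
  by exists (x 0 k - a 0 k) => //; apply/esym/(bigmaxe_fin _ _ i0I).
have maxJ x : exists2 b, (\big[maxe/-oo]_(i in ~: I) (x 0 i - a 0 i)%:E = b%:E)%E &
    (forall i, i \in (~: I)%SET -> x 0 i - a 0 i <= b) /\
    exists2 i, i \in (~: I)%SET & x 0 i - a 0 i = b.
  case: (@arg_maxP _ _ _ j0 (mem (~: I)%SET) (fun i => x 0 i - a 0 i) j0I) => k kI kmax.
  have H : (forall i, i \in (~: I)%SET -> x 0 i - a 0 i <= x 0 k - a 0 k) /\
      exists2 i, i \in (~: I)%SET & x 0 i - a 0 i = x 0 k - a 0 k by split=> //; exists k.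
  by exists (x 0 k - a 0 k) => //; apply/esym/(bigmaxe_fin _ _ j0I).
congr (tproj @` _); apply/seteqP; split=> x /=.
  move=> [X HX Xx]; have [be -> [beI _]] := maxI x; have [al -> [alJ [j jJ jal]]] := maxJ x.
  rewrite lee_fin leNgt; apply/negP => beal.
  have res : residue a f (fun i => f 0 i (a 0 i)).
    by exists 0 => i; rewrite add0r.
  have : dot f X < 0.
    apply: (residue_separates res Xx _ _ jal (fJ j jJ)) => i.
      case: (boolP (i \in I)) => iI; first by rewrite (le_trans (beI i iI)) // ltW.
      by apply: alJ; rewrite finset.in_setC.
    case: (boolP (i \in I)) => iI; last by move=> _; apply/ltW/fJ; rewrite finset.in_setC.
    by have := beI i iI => /[swap] ->; rewrite leNgt beal.
  by rewrite ltNge HX.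
have [be -> [beI [k kI kbe]]] := maxI x; have [al -> [alJ _]] := maxJ x.
rewrite lee_fin => albe.
have xbe i : - be + x 0 i <= a 0 i.
  case: (boolP (i \in I)) => iI; first by have := beI i iI; lra.
  have : x 0 i - a 0 i <= al by apply: alJ; rewrite finset.in_setC.
  by lra.
pose g i := f 0 i (- be + x 0 i).
have res : residue x f g by exists (- be) => i //; apply: low_le (lf i).
have gk : 0 < g k by rewrite /g -kbe opprB subrK fI.
(* With this [c] the dominant positive term at [k] exceeds by 1 all that the terms outside [I] can
   subtract. *)
pose c := (1 + \sum_(j in ~: I) `|g j|) / g k.
pose z i := if i \in I then c else 1.
have c0 : 0 < c by rewrite divr_gt0 // ltr_pwDl // sumr_ge0.
exists (real_point x z); last first.
  move=> i; rewrite mxE; have zi : 0 < z i by rewrite /z; case: ifP.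
  by rewrite mono_gt0 // hval_mono // opprK.
apply/ltW/(residue_real_point res).
rewrite /pairing (bigID (mem I)) /= (bigD1 k) //= /z kI /c divfK ?gt_eqF //.
set A := \sum_(i < n | _ && _) _; have A0 : 0 <= A.
  apply: sumr_ge0 => i /andP[iI _]; rewrite iI -/c mulr_ge0 ?(ltW c0) //.
  by apply: low_ge0; [apply: low_le (lf i) | move: iI; rewrite inE => /ltW].
have : \sum_(i < n | i \notin I) (if i \in I then c else 1) * g i >= - \sum_(j in ~: I) `|g j|.
  rewrite -sumrN (eq_bigl (fun i => i \notin I)) => [|i]; last by rewrite finset.in_setC.
  by apply: ler_sum => i /negPf ->; rewrite mul1r lerNl -normrN ler_norm.
rewrite -/c; lra.
Qed.

End HalfspaceImage.

(** * Valuation images of facet-defining half-spaces *)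

Section FacetImages.
Context {R : realType} {n p : nat}.
Variables (v : 'I_p -> 'rV[R]_n) (C : 'I_p -> 'I_n -> R).
Hypotheses (n_ge2 : (2 <= n)%N) (p_gt0 : (0 < p)%N).
Hypothesis C_gt0 : forall r i, 0 < C r i.
Local Notation V := (lifted v C).

Let V_gt0 r i : 0 < V r 0 i. Proof. by rewrite mxE mono_gt0. Qed.

(** Since n is at least 2, the facet contains a generator. Its entries are positive and [f] vanishes
    at it, so [f] has entries of both signs. *)
Lemma facet_tropical_halfspace (f : 'rV[hahn R]_n) :
  (forall i, f 0 i != 0) -> facet_normal V f ->
  is_tropical_halfspace (val_image (halfspace f)).
Proof.
move=> fn0 [f0 df rk].
have [r rT] : exists r, r \in tight V f.
  apply: contrapT => nT; move: rk.
  have -> : rows V (tight V f) = 0.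
    apply/row_matrixP => r; rewrite row_rows row0; case: ifP => // rT.
    by case: nT; exists r.
  by rewrite mxrank0; case: (n) n_ge2 => [|[]].
have i0 : 'I_n by exact: (Ordinal (ltnW n_ge2)).
have fr : dot f (V r) = 0 by move: rT; rewrite inE => /eqP.
have pos : exists i, 0 < f 0 i.
  apply: contrapT => np; have /lt_eqF/eqP[] : dot f (V r) < 0 => //.
  have neg i : f 0 i < 0.
    by rewrite lt_neqAle fn0 leNgt; apply/negP => fi; apply: np; exists i.
  rewrite /dot (bigD1 i0) // -[ltRHS]addr0 ltr_leD ?nmulr_rlt0 // sumr_le0 // => i _.
  by rewrite nmulr_rle0 // ltW.
have neg : exists i, f 0 i < 0.
  apply: contrapT => np; have /gt_eqF/eqP[] : 0 < dot f (V r) => //.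
  have fpos i : 0 < f 0 i.
    by rewrite lt_neqAle eq_sym fn0 leNgt; apply/negP => fi; apply: np; exists i.
  rewrite /dot (bigD1 i0) // ltr_pwDl ?mulr_gt0 // sumr_ge0 // => i _.
  by rewrite ltW // mulr_gt0.
exists (\row_i alpha_min (f 0 i)), [set i | 0 < f 0 i]%SET; split.
- by have [i fi] := pos; apply/set0Pn; exists i; rewrite inE.
- have [i fi] := neg; apply/eqP => /setP/(_ i); rewrite !inE.
  by rewrite ltNge (ltW fi).
- exact: val_image_halfspace.
Qed.

(** The combination of the generators with coefficients t^(-lam_r) is a lift of the given point: all
    coefficients are positive, so the leading terms add up without cancellation. *)
Lemma polytope_sub_val_image (H : set 'rV[hahn R]_n) : cone V `<=` H ->
  tropical_polytope v `<=` val_image H.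
Proof.
move=> VH X; have [x ->] := tproj_surj X => /(polytopeP _ _ p_gt0)[lam [H1 H2]].
exists x => //; exists (\sum_r mono 1 (- lam r) *: V r).
  by apply: VH; exists (fun r => mono 1 (- lam r)) => // r; rewrite ltW ?mono_gt0.
move=> i; rewrite summxE.
have E r : (mono 1 (- lam r) *: V r) 0 i = mono (C r i) (- (lam r + v r 0 i)).
  by rewrite !mxE mono_mul mul1r opprD.
under eq_bigr => r _ do rewrite E.
set S := \sum_r _; have lS : low (- x 0 i) S.
  apply: low_sum => r _; apply: (low_le _ (@low_mono _ _ _)).
  by rewrite lerN2.
have Sx : 0 < S (- x 0 i).
  have [r rE] := H2 i; rewrite hcoef_sum (bigD1 r) // ltr_pwDl //.
    by rewrite hcoef_mono rE eqxx.
  by apply: sumr_ge0 => s _; rewrite hcoef_mono; case: ifP => // _; exact: ltW.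
have S0 : 0 < S by exact: low_gt0 lS Sx.
split=> //; rewrite /hval gt_eqF //; congr EFin; rewrite -[RHS]opprK; congr (- _).
apply: alpha_min_least; split; first by rewrite /supp /mkset gt_eqF.
by move=> b Sb; rewrite leNgt; apply: contra Sb => /lS ->.
Qed.

End FacetImages.

(** * The perturbed lift and its minors *)

Lemma lift_vectorsE (R : realType) n p (v gamma : 'I_p -> 'rV[R]_n) mu nu : 0 < mu ->
  lift_vectors (perturbed v gamma) mu nu =
  lifted v (typed_coef v (fun r i => nu `^ (- gamma r 0 i)) mu^-1).
Proof.
move=> mu0; apply/funext => r; apply/rowP => i; rewrite !mxE.
congr mono; rewrite /pi2 /pi3 /perturbed /= /typed_coef /gen_type /extreme_dir.
case: pickP => [k _|_]; last by rewrite mxE oppr0 powRr0 mul1r.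
rewrite mxE eqxx /=; have [->|ik] := eqVneq i k.
  by rewrite eqxx powR_inv1 // ltW.
rewrite ifF ?oppr0 ?powRr0 ?mul1r //.
by apply/eqP => -[ki]; move: ik; rewrite ki eqxx.
Qed.

(** There are finitely many minors, so [minor_neq0] holds for all of them at once near 0. Encoding
    the selections [h] as finite functions makes their type finite. *)
Lemma minors_neq0 (R : realType) n p (v gamma : 'I_p -> 'rV[R]_n) :
  general_position gamma ->
  \forall nu \near 0^'+, \forall mu \near 0^'+,
  forall (k : 'I_n) (h : {ffun 'I_n.-1 -> 'I_p}), {homo h : a b / (a < b)%N} ->
  \det (\matrix_(a, b) lifted v (typed_coef v (fun r i => nu `^ (- gamma r 0 i)) mu^-1)
     (h b) 0 (lift k a)) != 0.
Proof.
move=> gg.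
have H (k : 'I_n) (h : {ffun 'I_n.-1 -> 'I_p}) :
    \forall nu \near 0^'+, \forall mu \near 0^'+, {homo h : a b / (a < b)%N} ->
    \det (\matrix_(a, b) lifted v (typed_coef v (fun r i => nu `^ (- gamma r 0 i)) mu^-1)
       (h b) 0 (lift k a)) != 0.
  have [hmono|nh] := pselect {homo h : a b / (a < b)%N}; last first.
    by apply: nearW => nu; apply: nearW => mu.
  pose W : 'M[R]_n.-1 := \matrix_(a, b) v (h b) 0 (lift k a).
  pose G : 'M[R]_n.-1 := \matrix_(a, b) gamma (h b) 0 (lift k a).
  have nsG : ~ tropically_singular G.
    have kmono : {homo lift k : a b / (a < b)%N}.
      by move=> a b ab; rewrite ltnNge /= leq_bump2 -ltnNge.
    have := gg _ _ _ kmono hmono; congr (~ tropically_singular _).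
    by apply/matrixP => a b; rewrite !mxE.
  have := minor_neq0 W (fun a b => gen_type v (h b) == Some (lift k a)) nsG.
  apply: filterS => nu; apply: filterS => mu Hdet _; move: Hdet.
  congr (\det _ != 0); apply/matrixP => a b; rewrite !mxE /typed_coef.
  by case: eqP => _; rewrite ?expr1 // expr0 mul1r.
have : \forall nu \near 0^'+, forall kh : 'I_n * {ffun 'I_n.-1 -> 'I_p},
    \forall mu \near 0^'+, {homo kh.2 : a b / (a < b)%N} ->
    \det (\matrix_(a, b) lifted v (typed_coef v (fun r i => nu `^ (- gamma r 0 i)) mu^-1)
       (kh.2 b) 0 (lift kh.1 a)) != 0.
  by apply: filter_forall => kh; exact: H.
apply: filterS => nu Hnu.
have Hn := @filter_forall _ _ _ (0 : R)^'+ (at_right_proper_filter 0) Hnu.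
by apply: (filterS _ Hn) => mu Hmu k h; exact: (Hmu (k, h)).
Qed.

Theorem proposition25 (R : realType) (n p : nat)
    (v gamma : 'I_p -> 'rV[R]_n)
    (n_ge2 : (2 <= n)%N) (p_ge1 : (1 <= p)%N)
    (v_distinct : injective (fun r => tproj (v r)))
    (v_pure : pure (tropical_polytope v))
    (gamma_general : general_position gamma) :
  exists2 nu0 : R, 0 < nu0 & forall nu : R, 0 < nu < nu0 ->
  exists2 mu0 : R, 0 < mu0 & forall mu : R, 0 < mu < mu0 ->
    let P := cone (lift_vectors (perturbed v gamma) mu nu) in
    is_lift v P /\
    external_representation (val_image @` facet_defining P)
      (tropical_polytope v).
Proof.
have n_gt0 : (0 < n)%N by apply: leq_trans n_ge2.
have /near_right0P[nu0 nu0_gt0 Hnu] := minors_neq0 v gamma_general.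
exists nu0 => // nu nu_lt; have nu_gt0 : 0 < nu by case/andP: nu_lt.
pose b (r : 'I_p) (i : 'I_n) := nu `^ (- gamma r 0 i).
have b_gt0 r i : 0 < b r i by exact: powR_gt0.
(* A common bound for all [b r i] and their inverses, independent of mu. *)
pose B := 1 + \sum_r \sum_i (b r i + (b r i)^-1).
have bB r i : b r i + (b r i)^-1 <= B.
  have b0 s k : 0 <= b s k + (b s k)^-1 by rewrite addr_ge0 ?invr_ge0 ?(ltW (b_gt0 _ _)).
  rewrite /B (bigD1 r) //= (bigD1 i) //= addrCA -addrA lerDl.
  by rewrite addr_ge0 ?addr_ge0 ?sumr_ge0 // => s _; rewrite sumr_ge0.
have B1 : 1 <= B.
  rewrite lerDl sumr_ge0 // => r _; rewrite sumr_ge0 // => i _.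
  by rewrite addr_ge0 ?invr_ge0 ?(ltW (b_gt0 _ _)).
have b_bounds r i : 1 <= B * b r i /\ b r i <= B.
  have b0 := b_gt0 r i; split; last first.
    by apply: le_trans (bB r i); rewrite lerDl invr_ge0 (ltW b0).
  by rewrite -ler_pdivrMr // div1r; apply: le_trans (bB r i); rewrite lerDr (ltW b0).
(* The threshold for L = 1/mu; it depends on nu through [B], hence the order in which nu and mu are
   chosen. *)
pose M := 16 * n%:R ^+ 2 * B ^+ 8.
have M0 : 0 < M.
  by rewrite !mulr_gt0 ?exprn_gt0 // ?ltr0n // (lt_le_trans _ B1).
have : \forall mu \near 0^'+, mu < M^-1 /\ forall (k : 'I_n) (h : {ffun 'I_n.-1 -> 'I_p}),
    {homo h : a b / (a < b)%N} -> \det (\matrix_(a, b')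
      lifted v (typed_coef v b mu^-1) (h b') 0 (lift k a)) != 0.
  apply: filterI; last exact: Hnu.
  by apply: nbhs_right_lt; rewrite invr_gt0.
move=> /near_right0P[mu0 mu0_gt0 Hmu]; exists mu0 => // mu mu_lt.
have mu_gt0 : 0 < mu by case/andP: mu_lt.
have [muM minors] := Hmu mu mu_lt.
have LM : M <= mu^-1 by rewrite -[M]invrK lef_pV2 ?posrE ?invr_gt0 // ltW.
rewrite lift_vectorsE // -/b; set C := typed_coef v b mu^-1; set V := lifted v C => P.
have C_gt0 r i : 0 < C r i by apply: (typed_coef_gt0 v n_gt0 B1 LM b_bounds).
have spV : spanning V by exact: (lifted_spanning n_gt0 p_ge1 v_pure B1 LM b_bounds).
split.
  by exists V => // r i; rewrite mxE mono_gt0 // hval_mono // opprK.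
split.
- exact/finite_image/finite_facets.
- move=> _ [H /facet_definingP[f ff ->] <-].
  apply: (facet_tropical_halfspace n_ge2 C_gt0 _ ff) => i.
  apply: (facet_normal_neq0 _ _ ff) => k h hmono.
  suff -> : \matrix_(a, b') V (h b') 0 (lift k a) =
      \matrix_(a, b') V ([ffun a' => h a'] b') 0 (lift k a).
    by apply: minors => a b' ab; rewrite !ffunE; exact: hmono.
  by apply/matrixP => a b'; rewrite !mxE ffunE.
- apply/seteqP; split=> X.
    have [x ->] := tproj_surj X => HX; apply: contrapT => nPx.
    (* A point outside the polytope is cut off by a single facet, which excludes all lifts of all
       its representatives. *)
    have [f ff fsep] := separating_facet n_gt0 p_ge1 v_pure B1 LM b_bounds nPx.
    have [|x' [Z HZ Zx'] x'E] := HX (val_image (halfspace f)).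
      by exists (halfspace f) => //; exact: facet_normalP.
    by have := fsep x' Z (esym x'E) Zx'; rewrite ltNge HZ.
  move=> PX _ [H /facet_definingP[f [_ df _] ->] <-].
  by apply: (polytope_sub_val_image p_ge1 C_gt0) PX; exact/dualP.
Qed.
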